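(* Let $\mu$ be an inductive valuation on $K(x)$ and let $\phi$ be a proper key polynomial for $\mu$. Let $\nu\in\mathbb Q_{>0}$ and $\mu'=[\mu;\phi,\nu]$. Consider any two MacLane chains of $\mu$, $$\mu_0\xrightarrow{\phi_1,\nu_1}\mu_1\to\cdots\xrightarrow{\phi_r,\nu_r}\mu_r=\mu,\qquad \mu_0\xrightarrow{\phi^*_1,\nu^*_1}\mu^*_1\to\cdots\xrightarrow{\phi^*_{r^*},\nu^*_{r^*}}\mu^*_{r^*}=\mu,$$ such that $\phi\nmid_\mu\phi_r$ and $\phi\nmid_\mu\phi^*_{r^*}$, and extend each of them to a MacLane chain of $\mu'$ by adding the augmentation step $\mu\xrightarrow{\phi,\nu}\mu'$. Then the elements $p_{r+1}\in\mathcal{G}r(\mu')^*$, $x_{r+1}\in\mathcal{G}r(\mu')$, $y_{r+1}\in\Delta(\mu')$ and the operators $N_{r+1}$, $R_{r+1}$ attached to the first extended chain coincide with the elements $p^*_{r^*+1},x^*_{r^*+1},y^*_{r^*+1}$ and operators $N^*_{r^*+1},R^*_{r^*+1}$ attached to the second extended chain. In other words, these generators of $\mathcal{G}r(\mu')$ and the operators $N_{r+1},R_{r+1}$ depend only on $\mu,\phi,\nu$ and not on the chosen MacLane chain of $\mu$.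
   Context: Let $K$ be a field with a surjective discrete valuation $v\colon K^*\to\mathbb Z$, valuation ring $\mathcal O$, maximal ideal $\mathfrak m$, a fixed generator $\pi$ of $\mathfrak m$, residue field $\mathbb F=\mathcal O/\mathfrak m$. Let $\mathbb V$ be the set of valuations $\mu\colon K(x)^*\to\mathbb Q$ with $\mu|_K=v$ and $\mu(x)\ge0$, ordered by $\mu\le\mu'$ iff $\mu(g)\le\mu'(g)$ for all $g\in K[x]$. The Gauss valuation is $\mu_0(\sum_s a_sx^s)=\min_s v(a_s)$. For $\mu\in\mathbb V$, $\Gamma(\mu)=\mu(K(x)^* )$ and $e(\mu)$ is the positive integer with $e(\mu)\Gamma(\mu)=\mathbb Z$. For $\alpha\in\Gamma(\mu)$ let $\mathcal P_\alpha=\{g\in K[x]:\mu(g)\ge\alpha\}$, $\mathcal P^+_\alpha=\{g:\mu(g)>\alpha\}$; $\mathcal{G}r(\mu)=\bigoplus_{\alpha}\mathcal P_\alpha/\mathcal P_\alpha^+$ is the graded algebra, $\Delta(\mu)=\mathcal P_0/\mathcal P_0^+$ its degree-zero part, and for $g\ne0$, $H_\mu(g)$ is the class of $g$ in $\mathcal P_{\mu(g)}/\mathcal P^+_{\mu(g)}$. If $\mu\le\mu'$ there is a canonical graded homomorphism $\mathcal{G}r(\mu)\to\mathcal{G}r(\mu')$, $g+\mathcal P^+_\alpha(\mu)\mapsto g+\mathcal P^+_\alpha(\mu')$. Write $\phi\mid_\mu g$ if $H_\mu(\phi)$ divides $H_\mu(g)$ in $\mathcal{G}r(\mu)$, and $g\sim_\mu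 h$ if $H_\mu(g)=H_\mu(h)$. A key polynomial for $\mu$ is a monic $\phi\in K[x]$ such that $H_\mu(\phi)\mathcal{G}r(\mu)$ is a nonzero prime ideal and $\phi\nmid_\mu h$ for all nonzero $h$ with $\deg h<\deg\phi$; $\mathrm{KP}(\mu)$ denotes the set of them. For $\phi\in\mathrm{KP}(\mu)$, $\nu\in\mathbb Q_{>0}$, the augmented valuation $[\mu;\phi,\nu]$ is $g=\sum_s a_s\phi^s\mapsto\min_s\{\mu(a_s\phi^s)+s\nu\}$, where $\sum a_s\phi^s$ is the $\phi$-expansion ($\deg a_s<\deg\phi$). A MacLane chain of length $r$ of $\mu$ is a sequence $\mu_0\xrightarrow{\phi_1,\nu_1}\mu_1\to\cdots\xrightarrow{\phi_r,\nu_r}\mu_r=\mu$ with $\phi_i\in\mathrm{KP}(\mu_{i-1})$, $\nu_i\in\mathbb Q_{>0}$, $\mu_i=[\mu_{i-1};\phi_i,\nu_i]$, and $\phi_{i+1}\nmid_{\mu_i}\phi_i$ for $1\le i<r$; $\mu$ is inductive if it has one. Set $\phi_0=x$, $\nu_0=0$, $\mu_{-1}=\mu_0$. A key polynomial $\phi$ for $\mu$ is proper if $\mu$ admits a MacLane chain (of some length $r$) with $\phi\nmid_\mu\phi_r$. Data of a MacLane chain: $\Delta_i=\Delta(\mu_i)$, $\mathbb F_0=\mathbb F$, $\mathbb F_i=\mathrm{Im}(\Delta_{i-1}\to\Delta_i)$; for $0\le i\le r$, $e_i=e(\mu_i)/e(\mu_{i-1})$, $h_i=e(\mu_i)\nu_i$,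 $V_i=e(\mu_{i-1})\mu_{i-1}(\phi_i)$, and $\ell_i,\ell'_i\in\mathbb Z$ with $\ell_ih_i+\ell'_ie_i=1$, $0\le\ell_i<e_i$. Generators: $p_0=H_{\mu_0}(\pi)$ and recursively $x_i=H_{\mu_i}(\phi_i)p_i^{-V_i}$, $y_i=x_i^{e_i}p_i^{-h_i}\in\Delta_i$, $p_{i+1}=x_i^{\ell_i}p_i^{\ell'_i}$ (images of $x_i,p_i$ in $\mathcal{G}r(\mu_{i+1})$); $p_i$ is a unit, $y_i$ is transcendental over $\mathbb F_i$ and $\Delta_i=\mathbb F_i[y_i]$. For an inductive $\mu$, $\phi\in\mathrm{KP}(\mu)$ and nonzero $g=\sum_s a_s\phi^s$, the Newton polygon $N_{\mu,\phi}(g)$ is the lower convex hull of $\{(s,\mu(a_s\phi^s))\}$; for $\nu>0$ its $\nu$-component is its intersection with the line of slope $-\nu$ first touching it from below. $N_i:=N_{\mu_{i-1},\phi_i}$. Residual polynomial operators $R_i\colon K[x]\to\mathbb F_i[y]$: for $g\ne0$ put $s_0(g)=0,u_0(g)=\mu_0(g)$, and for $i\ge1$ let $(s_i(g),u_i(g)/e(\mu_{i-1}))$ be the left end point of the $\nu_i$-component of $N_i(g)$; $R_i(g)$ is the unique polynomial in $\mathbb F_i[y]$ with $H_{\mu_i}(g)=x_i^{s_i(g)}p_i^{u_i(g)}R_i(g)(y_i)$. For the extended chain of length $r+1$ ending in $\mu\xrightarrow{\phi,\nu}\mu'$, these definitions give $p_{r+1},x_{r+1},y_{r+1},N_{r+1}=N_{\mu,\phi},R_{r+1}$.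 *)

(* Defs.v *)
From HB Require Import structures.
From mathcomp Require Import all_boot all_order all_algebra.
From mathcomp Require Import finmap boolp classical_sets.
From mathcomp.multinomials Require Import monalg.

Set Implicit Arguments.
Unset Strict Implicit.
Unset Printing Implicit Defensive.

Import Order.TTheory GRing.Theory Num.Theory.

Local Open Scope ring_scope.
Local Open Scope quotient_scope.
Local Open Scope classical_set_scope.

Notation "g %:F" := (FracField.tofrac g) : ring_scope.

(** * Valuations on [K] and on [K(x)] *)

(* Valuations are total functions, but they are only constrained, and their
   values only used, at nonzero arguments. *)
Record discrete_valuation (K : fieldType) := DiscreteValuation {
  dval :> K -> int;
  dvalM : forall a b, a != 0 -> b != 0 -> dval (a * b) = dval a + dval b;
  dvalD : forall a b, a != 0 -> b != 0 -> a + b != 0 ->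
    Order.min (dval a) (dval b) <= dval (a + b);
  dval_surj : forall n : int, exists2 a, a != 0 & dval a = n
}.

Section BaseField.
Variables (K : fieldType) (v : discrete_valuation K).

Definition valuation_ring : set K := [set a | a = 0 \/ 0 <= v a].
Definition maximal_ideal : set K := [set a | a = 0 \/ 0 < v a].

Definition generates_maximal_ideal (pi : K) : Prop :=
  maximal_ideal pi /\
  forall a, maximal_ideal a -> exists2 b, valuation_ring b & a = b * pi.

End BaseField.

(* General facts, stated for an abstract field because computing in
   {fraction _} is slow. *)
Section Multiplicative.
Variables (L : fieldType) (A : numDomainType) (w : L -> A).
Hypothesis wM : forall a b, a != 0 -> b != 0 -> w (a * b) = w a + w b.

Lemma mult1 : w 1 = 0.
Proof. by apply: (addrI (w 1)); rewrite addr0 -wM ?oner_neq0 ?mulr1. Qed.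

Lemma multN a : a != 0 -> w (- a) = w a.
Proof.
move=> a0; have n0 : (-1 : L) != 0 by rewrite oppr_eq0 oner_neq0.
have /esym/eqP := wM n0 n0.
rewrite mulrNN mulr1 mult1 -mulr2n mulrn_eq0 /= => /eqP vN1.
by rewrite -mulN1r wM // vN1 add0r.
Qed.

End Multiplicative.

Lemma frac_mul (L : fieldType) (f g a b c d : L) :
  f * b = a -> g * d = c -> (f * g) * (b * d) = a * c.
Proof. by move=> <- <-; rewrite mulrACA. Qed.

Lemma frac_add (L : fieldType) (f g a b c d : L) :
  f * b = a -> g * d = c -> (f + g) * (b * d) = a * d + b * c.
Proof.
by move=> <- <-; rewrite mulrDl mulrA [in X in _ + X]mulrCA.
Qed.

Lemma frac_eq (L : fieldType) (f a b c d : L) :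
  f * b = a -> f * d = c -> a * d = c * b.
Proof. by move=> <- <-; rewrite mulrAC. Qed.

(* The junk value [kval0] makes Leibniz equality of valuations coincide with
   equality of functions on K(x)^* (see [valuation_ext]). *)
Record valuation (K : fieldType) (v : discrete_valuation K) := Valuation {
  kval :> {fraction {poly K}} -> rat;
  kval0 : kval 0 = 0;
  kvalM : forall f g, f != 0 -> g != 0 -> kval (f * g) = kval f + kval g;
  kvalD : forall f g, f != 0 -> g != 0 -> f + g != 0 ->
    Order.min (kval f) (kval g) <= kval (f + g);
  kval_base : forall a : K, a != 0 -> kval (a%:P)%:F = (v a)%:~R;
  kval_X : 0 <= kval 'X%:F
}.

Section ValuationTheory.
Variables (K : fieldType) (v : discrete_valuation K).
Implicit Types (mu : valuation v) (f g : {fraction {poly K}}).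

Lemma valuation_ext mu mu' : (forall f, f != 0 -> mu f = mu' f) -> mu = mu'.
Proof.
case: mu => m m0 mM mD mb mX; case: mu' => n n0 nM nD nb nX /= E.
have eq_mn : m = n.
  apply: funext => f; have [->|/E//] := eqVneq f 0; by rewrite m0 n0.
by case: n / eq_mn n0 nM nD nb nX {E} => *; congr Valuation; apply: Prop_irrelevance.
Qed.

Lemma kval1 mu : mu 1 = 0. Proof. exact: (mult1 (@kvalM _ _ mu)). Qed.

Lemma kvalN mu f : f != 0 -> mu (- f) = mu f.
Proof. exact: (multN (@kvalM _ _ mu)). Qed.

Definition value_group mu : set rat := mu @` [set f | f != 0].

Definition ramification mu : nat :=
  xget 0%N [set e | (0 < e)%N /\
    [set e%:R * a | a in value_group mu] = range (intr : int -> rat)].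

Definition valuation_le mu mu' : Prop :=
  forall g : {poly K}, g != 0 -> mu g%:F <= mu' g%:F.

Definition Pge mu (alpha : rat) : set {poly K} :=
  [set g | g = 0 \/ alpha <= mu g%:F].
Definition Pgt mu (alpha : rat) : set {poly K} :=
  [set g | g = 0 \/ alpha < mu g%:F].

End ValuationTheory.

(** * The Gauss valuation *)

Section Gauss.
Variables (K : fieldType) (v : discrete_valuation K).
Implicit Types g h : {poly K}.

Lemma dval1 : v 1 = 0. Proof. exact: (mult1 (@dvalM _ v)). Qed.

Definition gauss_poly g : int :=
  \big[Order.min/v (lead_coef g)]_(i < size g | g`_i != 0) v g`_i.

Lemma gauss_poly_le g i : g`_i != 0 -> gauss_poly g <= v g`_i.
Proof.
move=> gi; have lti : (i < size g)%N.
  by rewrite ltnNge; apply: contra gi => /leq_sizeP->.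
exact: (@bigmin_le_cond _ _ _ _ (Ordinal lti) (fun i : 'I__ => g`_i != 0)
  (fun i : 'I__ => v g`_i)).
Qed.

Lemma gauss_poly_ge g (n : int) : g != 0 ->
  (forall i, g`_i != 0 -> n <= v g`_i) -> n <= gauss_poly g.
Proof.
move=> g0 ge_n; apply/bigmin_geP; split; last by move=> i; apply: ge_n.
by apply: ge_n; rewrite -lead_coefE lead_coef_eq0.
Qed.

Lemma gauss_poly_first g : g != 0 -> exists i, [/\ g`_i != 0,
  v g`_i = gauss_poly g &
  forall j, (j < i)%N -> g`_j != 0 -> gauss_poly g < v g`_j].
Proof.
move=> g0.
have : exists i, (g`_i != 0) && (v g`_i <= gauss_poly g).
  apply: contrapT => /forallNP no.
  have : gauss_poly g + 1 <= gauss_poly g.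
    apply: gauss_poly_ge => // i gi; rewrite lezD1 ltNge; apply/negP => le.
    by apply: (no i); rewrite gi.
  by rewrite gerDl.
move=> ex; case: (ex_minnP ex) => i /andP[gi le] mini; exists i; split=> //.
  by apply/eqP; rewrite eq_le le gauss_poly_le.
move=> j ltji gj; rewrite ltNge; apply/negP => lej.
by have := mini j; rewrite gj lej => /(_ isT); rewrite leqNgt ltji.
Qed.

Lemma dval_sum_ge (I : Type) (r : seq I) (P : pred I) (F : I -> K) (n : int) :
  (forall i, P i -> F i != 0 -> n <= v (F i)) ->
  \sum_(i <- r | P i) F i != 0 -> n <= v (\sum_(i <- r | P i) F i).
Proof.
move=> ge_n; elim/big_ind: _ => //; first by rewrite eqxx.
move=> a b IHa IHb.
have [->|a0] := eqVneq a 0; first by rewrite add0r.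
have [->|b0] := eqVneq b 0; first by rewrite addr0.
move=> ab0; apply: (le_trans _ (dvalD v a0 b0 ab0)).
by rewrite le_min IHa ?IHb.
Qed.

Lemma dvalN a : a != 0 -> v (- a) = v a.
Proof. exact: (multN (@dvalM _ v)). Qed.

Lemma dval_dominated a b : a != 0 -> (b != 0 -> v a < v b) ->
  a + b != 0 /\ v (a + b) = v a.
Proof.
move=> a0; have [->|b0 /(_ isT) lt] := eqVneq b 0; first by rewrite addr0.
have ab0 : a + b != 0.
  apply/eqP => /eqP; rewrite addr_eq0 => /eqP ab.
  by move: lt; rewrite ab dvalN // ltxx.
split=> //; apply/eqP; rewrite eq_le; apply/andP; split; last first.
  by have := dvalD v a0 b0 ab0; rewrite minElt lt.
have nb0 : - b != 0 by rewrite oppr_eq0.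
have := dvalD v ab0 nb0; rewrite addrK dvalN // => /(_ a0).
by rewrite ge_min [v b <= _]leNgt lt orbF.
Qed.

Lemma gauss_polyM g h : g != 0 -> h != 0 ->
  gauss_poly (g * h) = gauss_poly g + gauss_poly h.
Proof.
move=> g0 h0; have gh0 : g * h != 0 by rewrite mulf_neq0.
have term_ge i j : g`_i * h`_j != 0 ->
    gauss_poly g + gauss_poly h <= v (g`_i * h`_j).
  rewrite mulf_eq0 negb_or => /andP[gi hj].
  by rewrite dvalM // lerD ?gauss_poly_le.
apply/eqP; rewrite eq_le; apply/andP; split; last first.
  apply: gauss_poly_ge => // k; rewrite coefM => k0.
  by apply: dval_sum_ge k0 => i _; apply: term_ge.
have [s [gs vs mins]] := gauss_poly_first g0.
have [t [ht vt mint]] := gauss_poly_first h0.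
have lts : (s < (s + t).+1)%N by rewrite ltnS leq_addr.
have gsht0 : g`_s * h`_t != 0 by rewrite mulf_neq0.
have vst : v (g`_s * h`_t) = gauss_poly g + gauss_poly h.
  by rewrite dvalM // vs vt.
have [] := @dval_dominated (g`_s * h`_t)
  (\sum_(i < (s + t).+1 | i != Ordinal lts) g`_i * h`_(s + t - i)) gsht0.
  move=> sum0; rewrite vst -lezD1; apply: dval_sum_ge sum0 => i nei ij0.
  move: (ij0); rewrite mulf_eq0 negb_or => /andP[gi hj].
  rewrite lezD1 dvalM //.
  have : (i != s :> nat) by [].
  case: (ltngtP i s) => // cmp _.
    by apply: ltr_leD; [apply: mins | apply: gauss_poly_le].
  apply: ler_ltD; first exact: gauss_poly_le.
  apply: mint => //; rewrite ltn_subLR; last by rewrite -ltnS.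
  by rewrite ltn_add2r.
have -> : g`_s * h`_t +
    \sum_(i < (s + t).+1 | i != Ordinal lts) g`_i * h`_(s + t - i) =
    (g * h)`_(s + t).
  by rewrite coefM [RHS](bigD1 (Ordinal lts)) //= addKn.
by move=> st0 vE; rewrite -vst -vE gauss_poly_le.
Qed.

Lemma gauss_polyD g h : g != 0 -> h != 0 -> g + h != 0 ->
  Order.min (gauss_poly g) (gauss_poly h) <= gauss_poly (g + h).
Proof.
move=> g0 h0 gh0; apply: gauss_poly_ge => // i; rewrite coefD.
have [->|gi] := eqVneq g`_i 0.
  by rewrite add0r => hi; rewrite ge_min gauss_poly_le ?orbT.
have [->|hi] := eqVneq h`_i 0.
  by rewrite addr0 ge_min gauss_poly_le.
move=> ghi; apply: (le_trans _ (dvalD v gi hi ghi)).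
by rewrite le_min !ge_min !gauss_poly_le ?orbT.
Qed.

Lemma gauss_polyC a : a != 0 -> gauss_poly a%:P = v a.
Proof.
move=> a0; apply/eqP; rewrite eq_le; apply/andP; split.
  by have := @gauss_poly_le a%:P 0%N; rewrite coefC /=; apply.
apply: gauss_poly_ge; rewrite ?polyC_eq0 // => i.
by rewrite coefC; case: (i == 0%N); rewrite ?eqxx.
Qed.

Lemma gauss_polyX : gauss_poly 'X = 0.
Proof.
apply/eqP; rewrite eq_le; apply/andP; split.
  by have := @gauss_poly_le 'X 1; rewrite coefX /= dval1 oner_neq0; apply.
apply: gauss_poly_ge; rewrite ?polyX_eq0 // => i.
by rewrite coefX; case: (i == 1%N); rewrite ?eqxx //= dval1.
Qed.

Definition gauss_fun (f : {fraction {poly K}}) : rat :=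
  if f == 0 then 0
  else (gauss_poly \n_(repr f) - gauss_poly \d_(repr f))%:~R.

Lemma frac_repr (f : {fraction {poly K}}) :
  f * (\d_(repr f))%:F = (\n_(repr f))%:F.
Proof.
rewrite -[f in LHS]reprK; unlock FracField.tofrac.
rewrite -[LHS]FracField.pi_mul; apply/eqP; rewrite FracField.equivf_def.
have d0 := denom_ratioP (repr f).
by rewrite /FracField.mulf !numden_Ratio ?reprK ?mulr1 ?oner_neq0 // mulrC.
Qed.

Lemma gauss_funE f (n d : {poly K}) : n != 0 -> d != 0 -> f * d%:F = n%:F ->
  gauss_fun f = (gauss_poly n - gauss_poly d)%:~R.
Proof.
move=> n0 d0 fE; rewrite /gauss_fun; case: eqP => [f0|/eqP f0].
  by move/esym/eqP: fE; rewrite f0 mul0r tofrac_eq0 (negPf n0).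
have d'0 := denom_ratioP (repr f).
have f'E := frac_repr f.
have n'0 : \n_(repr f) != 0.
  by rewrite -tofrac_eq0 -f'E mulf_neq0 ?tofrac_eq0.
have /eqP := frac_eq f'E fE; rewrite -!tofracM tofrac_eq => /eqP E.
have : gauss_poly \n_(repr f) + gauss_poly d = gauss_poly n + gauss_poly \d_(repr f).
  by rewrite -!gauss_polyM // E.
move=> gE; congr _%:~R; apply/eqP.
by rewrite subr_eq addrAC -gE addrK.
Qed.

Lemma frac_repr_neq0 (f : {fraction {poly K}}) :
  f != 0 -> \n_(repr f) != 0.
Proof.
move=> f0; have d0 := denom_ratioP (repr f).
by rewrite -tofrac_eq0 -frac_repr mulf_neq0 ?tofrac_eq0.
Qed.

Lemma gauss_fun_poly g : g != 0 -> gauss_fun g%:F = (gauss_poly g)%:~R.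
Proof.
move=> g0; rewrite (@gauss_funE _ g 1) ?oner_neq0 ?tofrac1 ?mulr1 //.
by rewrite gauss_polyC ?oner_neq0 // dval1 subr0.
Qed.

Lemma gauss_fun0 : gauss_fun 0 = 0. Proof. by rewrite /gauss_fun eqxx. Qed.

Lemma gauss_funM (f g : {fraction {poly K}}) : f != 0 -> g != 0 ->
  gauss_fun (f * g) = gauss_fun f + gauss_fun g.
Proof.
move=> f0 g0.
have [fE gE] := (frac_repr f, frac_repr g).
have [nf0 ng0] := (frac_repr_neq0 f0, frac_repr_neq0 g0).
have [df0 dg0] := (denom_ratioP (repr f), denom_ratioP (repr g)).
move: (frac_mul fE gE); rewrite -!tofracM => fgE.
rewrite (gauss_funE nf0 df0 fE) (gauss_funE ng0 dg0 gE).
rewrite (gauss_funE (mulf_neq0 nf0 ng0) (mulf_neq0 df0 dg0) fgE).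
by rewrite -intrD !gauss_polyM // opprD addrACA.
Qed.

Lemma gauss_funD (f g : {fraction {poly K}}) : f != 0 -> g != 0 -> f + g != 0 ->
  Order.min (gauss_fun f) (gauss_fun g) <= gauss_fun (f + g).
Proof.
move=> f0 g0 fg0.
have [fE gE] := (frac_repr f, frac_repr g).
have [nf0 ng0] := (frac_repr_neq0 f0, frac_repr_neq0 g0).
have [df0 dg0] := (denom_ratioP (repr f), denom_ratioP (repr g)).
move: (frac_add fE gE); rewrite -!tofracM -tofracD.
set n : {poly K} := \n_ _ * _ + _; set d := _ * \d_ _ => fgE.
have d0 : d != 0 by rewrite mulf_neq0.
have dF0 : d%:F != 0 by rewrite tofrac_eq0.
have n0 : n != 0 by rewrite -tofrac_eq0 -fgE (mulf_neq0 fg0 dF0).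
rewrite (gauss_funE nf0 df0 fE) (gauss_funE ng0 dg0 gE) (gauss_funE n0 d0 fgE).
have := gauss_polyD (mulf_neq0 nf0 dg0) (mulf_neq0 df0 ng0) n0.
have -> : gauss_poly d = gauss_poly \d_(repr f) + gauss_poly \d_(repr g).
  exact: gauss_polyM.
rewrite !gauss_polyM // !ge_min !ler_int.
case/orP => le; apply/orP; [left|right].
  by rewrite lerBrDr addrA subrK.
by rewrite lerBrDr addrCA subrK.
Qed.

Definition gauss : valuation v.
Proof.
apply: (@Valuation K v gauss_fun gauss_fun0 gauss_funM gauss_funD) => [a a0|].
  by rewrite gauss_fun_poly ?polyC_eq0 // gauss_polyC.
by rewrite gauss_fun_poly ?polyX_eq0 // gauss_polyX.
Defined.

End Gauss.

(** * Graded algebras *)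

(* The group algebra R[Q] of the additive group of rational numbers.  The
   ring structure of [{malg _[_]}] is not available because it excludes
   exponent monoids with nontrivial invertible elements. *)
Section RatGroupAlgebra.
Variable R : comNzRingType.

Definition ratalg : Type := {malg R[rat]}.
HB.instance Definition _ := GRing.Zmodule.on ratalg.
Implicit Types f g h : ratalg.

Definition ra_coef f (a : rat) : R := mcoeff a f.
Definition ra_single (a : rat) (c : R) : ratalg := mkmalgU a c.
Definition ra_supp f : {fset rat} := msupp f.

Definition ra_mul f g : ratalg :=
  \sum_(a <- ra_supp f) \sum_(b <- ra_supp g)
    ra_single (a + b) (ra_coef f a * ra_coef g b).
Definition ra_one : ratalg := ra_single 0 1.

Lemma ra_singleD a : {morph ra_single a : x y / x + y}.
Proof. exact: monalgUD. Qed.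

Lemma ra_single0 a : ra_single a 0 = 0.
Proof. exact: monalgU0. Qed.

Lemma ra_coefD a : {morph ra_coef^~ a : f g / f + g}.
Proof. exact: mcoeffD. Qed.

Lemma ra_coefB a : {morph ra_coef^~ a : f g / f - g}.
Proof. exact: mcoeffB. Qed.

Lemma ra_coef0 a : ra_coef 0 a = 0.
Proof. exact: mcoeff0. Qed.

Lemma ra_coef_sum a (I : Type) (r : seq I) (P : pred I) (F : I -> ratalg) :
  ra_coef (\sum_(i <- r | P i) F i) a = \sum_(i <- r | P i) ra_coef (F i) a.
Proof. exact: (big_morph _ (ra_coefD a) (ra_coef0 a)). Qed.

Lemma ra_coef_single a c b : ra_coef (ra_single a c) b = c *+ (a == b).
Proof. exact: mcoeffU. Qed.

Lemma ra_mulEw (d1 d2 : {fset rat}) f g :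
  (ra_supp f `<=` d1)%fset -> (ra_supp g `<=` d2)%fset ->
  ra_mul f g = \sum_(a <- d1) \sum_(b <- d2)
    ra_single (a + b) (ra_coef f a * ra_coef g b).
Proof.
move=> le1 le2; rewrite /ra_mul (big_fset_incl _ le1) /=.
  apply/eq_bigr => a _; apply/big_fset_incl => // b _ /mcoeff_outdom.
  by rewrite /ra_coef => ->; rewrite mulr0 ra_single0.
move=> a _ /mcoeff_outdom fa; rewrite big1 // => b _.
by rewrite /ra_coef fa mul0r ra_single0.
Qed.

Lemma ra_mulC : commutative ra_mul.
Proof.
move=> f g; rewrite /ra_mul exchange_big /=; apply/eq_bigr => a _.
by apply/eq_bigr => b _; rewrite addrC mulrC.
Qed.

Lemma ra_mulDl : left_distributive ra_mul +%R.
Proof.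
move=> f g h.
rewrite (ra_mulEw (msuppD_le f g) (fsubset_refl _)).
rewrite (ra_mulEw (fsubsetUl (ra_supp f) (ra_supp g)) (fsubset_refl (ra_supp h))).
rewrite (ra_mulEw (fsubsetUr (ra_supp f) (ra_supp g)) (fsubset_refl (ra_supp h))).
rewrite -big_split /=; apply/eq_bigr => a _.
rewrite -big_split /=; apply/eq_bigr => b _.
by rewrite ra_coefD mulrDl ra_singleD.
Qed.

Lemma ra_mulDr : right_distributive ra_mul +%R.
Proof. by move=> f g h; rewrite ra_mulC ra_mulDl !(ra_mulC _ f). Qed.

Lemma ra_mul0 f : ra_mul 0 f = 0.
Proof. by rewrite /ra_mul /ra_supp msupp0 big_seq_fset0. Qed.

Lemma ra_mul_single a b c d :
  ra_mul (ra_single a c) (ra_single b d) = ra_single (a + b) (c * d).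
Proof.
rewrite (@ra_mulEw [fset a]%fset [fset b]%fset) ?msuppU_le //.
by rewrite !big_seq_fset1 !ra_coef_single !eqxx.
Qed.

Lemma ratalgE f : f = \sum_(a <- ra_supp f) ra_single a (ra_coef f a).
Proof. exact: monalgE. Qed.

Lemma ra_mul_suml (I : Type) (r : seq I) (F : I -> ratalg) g :
  ra_mul (\sum_(i <- r) F i) g = \sum_(i <- r) ra_mul (F i) g.
Proof. by apply: (big_morph (ra_mul^~ g) (fun _ _ => ra_mulDl _ _ _) (ra_mul0 g)). Qed.

Lemma ra_mul_sumr (I : Type) (r : seq I) (F : I -> ratalg) g :
  ra_mul g (\sum_(i <- r) F i) = \sum_(i <- r) ra_mul g (F i).
Proof.
by rewrite ra_mulC ra_mul_suml; apply/eq_bigr => i _; rewrite ra_mulC.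
Qed.

Lemma ra_mulA : associative ra_mul.
Proof.
move=> f g h; rewrite (ratalgE f) !ra_mul_suml; apply/eq_bigr => a _.
rewrite (ratalgE g) ra_mul_suml !ra_mul_sumr ra_mul_suml.
apply/eq_bigr => b _; rewrite (ratalgE h) !ra_mul_sumr.
by apply/eq_bigr => c _; rewrite !ra_mul_single addrA mulrA.
Qed.

Lemma ra_mul1 : left_id ra_one ra_mul.
Proof.
move=> f; rewrite [in LHS](ratalgE f) ra_mul_sumr [RHS]ratalgE.
by apply/eq_bigr => a _; rewrite ra_mul_single add0r mul1r.
Qed.

Lemma ra_one_neq0 : ra_one != 0.
Proof.
apply/eqP => /(congr1 (ra_coef^~ 0)) /eqP.
by rewrite ra_coef_single eqxx ra_coef0 oner_eq0.
Qed.

HB.instance Definition _ := GRing.Zmodule_isComNzRing.Build ratalg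
  ra_mulA ra_mulC ra_mul1 ra_mulDl ra_one_neq0.

Lemma ra_coefM f g c : ra_coef (f * g) c =
  \sum_(a <- ra_supp f) \sum_(b <- ra_supp g)
    (ra_coef f a * ra_coef g b) *+ (a + b == c).
Proof.
rewrite ra_coef_sum; apply/eq_bigr => a _; rewrite ra_coef_sum.
by apply/eq_bigr => b _; rewrite ra_coef_single.
Qed.

Lemma ra_coef1 a : ra_coef 1 a = (0 == a)%:R.
Proof. exact: ra_coef_single. Qed.

End RatGroupAlgebra.

Section Graded.
Variables (K : fieldType) (v : discrete_valuation K) (mu : valuation v).
Implicit Types g h : {poly K}.

Lemma PgeD a g h : Pge mu a g -> Pge mu a h -> Pge mu a (g + h).
Proof.
rewrite /Pge /=; have [->|g0] := eqVneq g 0; first by rewrite add0r.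
have [->|h0] := eqVneq h 0; first by rewrite addr0.
case=> [/eqP|leg]; first by rewrite (negPf g0).
case=> [/eqP|leh]; first by rewrite (negPf h0).
have [->|gh0] := eqVneq (g + h) 0; [by left|right].
have := @kvalD _ _ mu g%:F h%:F; rewrite -tofracD !tofrac_eq0 => D.
by apply: le_trans (D g0 h0 gh0); rewrite le_min leg.
Qed.

Lemma PgtD a g h : Pgt mu a g -> Pgt mu a h -> Pgt mu a (g + h).
Proof.
rewrite /Pgt /=; have [->|g0] := eqVneq g 0; first by rewrite add0r.
have [->|h0] := eqVneq h 0; first by rewrite addr0.
case=> [/eqP|leg]; first by rewrite (negPf g0).
case=> [/eqP|leh]; first by rewrite (negPf h0).
have [->|gh0] := eqVneq (g + h) 0; [by left|right].
have := @kvalD _ _ mu g%:F h%:F; rewrite -tofracD !tofrac_eq0 => D.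
by apply: lt_le_trans (D g0 h0 gh0); rewrite lt_min leg.
Qed.

Lemma PgeN a g : Pge mu a g -> Pge mu a (- g).
Proof.
rewrite /Pge /=; have [->|g0] := eqVneq g 0; first by rewrite oppr0.
by rewrite tofracN kvalN ?tofrac_eq0 // => -[/eqP|]; [rewrite (negPf g0)|right].
Qed.

Lemma PgtN a g : Pgt mu a g -> Pgt mu a (- g).
Proof.
rewrite /Pgt /=; have [->|g0] := eqVneq g 0; first by rewrite oppr0.
by rewrite tofracN kvalN ?tofrac_eq0 // => -[/eqP|]; [rewrite (negPf g0)|right].
Qed.

Lemma PgeM a b g h : Pge mu a g -> Pge mu b h -> Pge mu (a + b) (g * h).
Proof.
rewrite /Pge /=; have [->|g0] := eqVneq g 0; first by left; rewrite mul0r.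
have [->|h0] := eqVneq h 0; first by left; rewrite mulr0.
case=> [/eqP|leg]; first by rewrite (negPf g0).
case=> [/eqP|leh]; first by rewrite (negPf h0).
by right; rewrite tofracM kvalM ?tofrac_eq0 // lerD.
Qed.

Lemma PgtM a b g h : Pge mu a g -> Pgt mu b h -> Pgt mu (a + b) (g * h).
Proof.
rewrite /Pge /Pgt /=; have [->|g0] := eqVneq g 0; first by left; rewrite mul0r.
have [->|h0] := eqVneq h 0; first by left; rewrite mulr0.
case=> [/eqP|leg]; first by rewrite (negPf g0).
case=> [/eqP|leh]; first by rewrite (negPf h0).
by right; rewrite tofracM kvalM ?tofrac_eq0 // ler_ltD.
Qed.

(* The subring of K[x][Q] of the finite sums of terms g of degree alpha with
   mu(g) >= alpha, i.e. the direct sum of the P_alpha, as a graded ring. *)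
Definition in_rees : {pred ratalg {poly K}} :=
  [pred f : ratalg {poly K} | `[< forall a, Pge mu a (ra_coef f a) >]].

Lemma rees_subring_closed : subring_closed in_rees.
Proof.
split=> [|f g /asboolP Pf /asboolP Pg|f g /asboolP Pf /asboolP Pg];
  apply/asboolP => a.
- rewrite ra_coef1; case: eqP => [<-|_]; [right|by left].
  by rewrite tofrac1 kval1.
- by rewrite ra_coefB; apply: PgeD (Pf a) _; apply: PgeN.
- rewrite ra_coefM.
  apply: (big_ind (Pge mu a)); [by left|exact: PgeD|move=> b _].
  apply: (big_ind (Pge mu a)); [by left|exact: PgeD|move=> c _].
  by case: eqP => [<-|_]; [exact: PgeM|left].
Qed.

Record rees := Rees { rees_val : ratalg {poly K}; _ : in_rees rees_val }.
HB.instance Definition _ := [isSub for rees_val].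
HB.instance Definition _ := [Choice of rees by <:].
HB.instance Definition _ := GRing.SubChoice_isSubComNzRing.Build
  (ratalg {poly K}) in_rees rees rees_subring_closed.

Lemma rees_val0 : rees_val 0 = 0. Proof. exact: (raddf0 \val). Qed.
Lemma rees_val1 : rees_val 1 = 1. Proof. exact: (rmorph1 \val). Qed.
Lemma rees_valD (f g : rees) : rees_val (f + g) = rees_val f + rees_val g.
Proof. exact: (raddfD \val). Qed.
Lemma rees_valB (f g : rees) : rees_val (f - g) = rees_val f - rees_val g.
Proof. exact: (raddfB \val). Qed.
Lemma rees_valM (f g : rees) : rees_val (f * g) = rees_val f * rees_val g.
Proof. by []. Qed.

Definition rees_plus : {pred rees} :=
  [pred f : rees | `[< forall a, Pgt mu a (ra_coef (rees_val f) a) >]].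

Lemma rees_plus_idealr : idealr_closed rees_plus.
Proof.
split.
- by apply/asboolP => a; left; rewrite rees_val0 ra_coef0.
- apply/negP => /asboolP/(_ 0); rewrite rees_val1 ra_coef1 eqxx /Pgt /=.
  by rewrite tofrac1 kval1 ltxx => -[/eqP|//]; rewrite oner_eq0.
- move=> f g h /asboolP Pg /asboolP Ph; apply/asboolP => a.
  rewrite rees_valD rees_valM ra_coefD; apply: PgtD => //; rewrite ra_coefM.
  apply: (big_ind (Pgt mu a)); [by left|exact: PgtD|move=> b _].
  apply: (big_ind (Pgt mu a)); [by left|exact: PgtD|move=> c _].
  case: eqP => [<-|_]; [apply: PgtM => //|by left].
  by case: f => f /= /asboolP.
Qed.

HB.instance Definition _ := isIdealr.Build rees rees_plus rees_plus_idealr.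

(* Gr(mu).  Degrees run through Q: the components of degree outside the value
   group are zero. *)
Definition Gr : Type := {ideal_quot rees_plus}.
HB.instance Definition _ := GRing.ComNzRing.on Gr.
HB.instance Definition _ := NzRingQuotient.on Gr.

Lemma Gr_eqP (f g : rees) :
  reflect (\pi_Gr f = \pi_Gr g) (f - g \in rees_plus).
Proof. by rewrite Quotient.idealrBE; apply: eqP. Qed.

Lemma pi_Gr1 : \pi_Gr 1 = 1.
Proof. exact: (rmorph1 \pi_{ideal_quot rees_plus}). Qed.
Lemma pi_GrB (f g : rees) : \pi_Gr (f - g) = \pi_Gr f - \pi_Gr g.
Proof. exact: (rmorphB \pi_{ideal_quot rees_plus}). Qed.
Lemma pi_GrM (f g : rees) : \pi_Gr (f * g) = \pi_Gr f * \pi_Gr g.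
Proof. exact: (rmorphM \pi_{ideal_quot rees_plus}). Qed.

Definition Gr_unit : {pred Gr} := [pred x | `[< exists y, y * x = 1 >]].
Definition Gr_inv (x : Gr) : Gr := xget x [set y | y * x = 1].

Lemma Gr_mulVx : {in Gr_unit, left_inverse 1 Gr_inv *%R}.
Proof. by move=> x /asboolP ex; apply: (xgetPex x ex). Qed.

Lemma Gr_unitPl (x y : Gr) : y * x = 1 -> Gr_unit x.
Proof. by move=> yx; apply/asboolP; exists y. Qed.

Lemma Gr_inv_out : {in [predC Gr_unit], Gr_inv =1 id}.
Proof.
move=> x /negP nex; apply: xgetPN => y yx; apply: nex.
by apply/asboolP; exists y.
Qed.

HB.instance Definition _ :=
  GRing.ComNzRing_hasMulInverse.Build Gr Gr_mulVx Gr_unitPl Gr_inv_out.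

End Graded.

Section GradedMaps.
Variables (K : fieldType) (v : discrete_valuation K).
Implicit Types (mu : valuation v) (g h : {poly K}).

(* The class of g in P_alpha / P_alpha^+, for g in P_alpha. *)
Definition gr_class mu (alpha : rat) g : Gr mu :=
  \pi_(Gr mu) (insubd (0 : rees mu) (ra_single alpha g)).

Lemma gr_class_eq0 mu alpha g : Pge mu alpha g ->
  gr_class mu alpha g = 0 <-> Pgt mu alpha g.
Proof.
move=> Pg; pose f := insubd (0 : rees mu) (ra_single alpha g).
have fE : rees_val f = ra_single alpha g.
  rewrite -[LHS]/(\val _) val_insubd ifT //; apply/asboolP => a.
  by rewrite ra_coef_single; case: eqP => [<-|_] //; left.
have -> : gr_class mu alpha g = 0 <-> f - 0 \in rees_plus (mu := mu).
  rewrite -(rwP (Gr_eqP f 0)); suff -> : \pi_(Gr mu) 0 = 0 by [].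
  by have := pi_GrB (0 : rees mu) 0; rewrite !subrr.
rewrite subr0; split=> [/asboolP/(_ alpha)|Pg'].
  by rewrite fE ra_coef_single eqxx.
apply/asboolP => a; rewrite fE ra_coef_single.
by case: eqP => [<-|_] //; left.
Qed.

(* H_mu(g); the value at g = 0 is 0. *)
Definition initial mu g : Gr mu := gr_class mu (mu g%:F) g.

Definition Delta mu : set (Gr mu) := gr_class mu 0 @` Pge mu 0.

Arguments Delta mu : clear implicits.

Definition gr_map mu mu' (z : Gr mu) : Gr mu' :=
  \pi_(Gr mu') (insubd (0 : rees mu') (rees_val (repr z))).

Lemma Pge_le mu mu' : valuation_le mu mu' ->
  forall a, Pge mu a `<=` Pge mu' a.
Proof.
move=> le a g [->|ag]; first by left.
have [->|g0] := eqVneq g 0; [by left|right].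
exact: le_trans ag (le _ g0).
Qed.

Lemma Pgt_le mu mu' : valuation_le mu mu' ->
  forall a, Pgt mu a `<=` Pgt mu' a.
Proof.
move=> le a g [->|ag]; first by left.
have [->|g0] := eqVneq g 0; [by left|right].
exact: lt_le_trans ag (le _ g0).
Qed.

Lemma rees_mapK mu mu' (f : rees mu) : valuation_le mu mu' ->
  rees_val (insubd (0 : rees mu') (rees_val f)) = rees_val f.
Proof.
move=> le; rewrite -[LHS]/(\val _) val_insubd ifT //.
by case: f => f /= /asboolP Pf; apply/asboolP => a; apply: Pge_le (Pf a).
Qed.

Lemma gr_map_pi mu mu' (f : rees mu) : valuation_le mu mu' ->
  gr_map mu' (\pi_(Gr mu) f) =
  \pi_(Gr mu') (insubd (0 : rees mu') (rees_val f)).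
Proof.
move=> le; rewrite /gr_map; set f' := repr _.
have /Gr_eqP/asboolP Pff' : \pi_(Gr mu) f' = \pi_(Gr mu) f by rewrite reprK.
apply/Gr_eqP; apply/asboolP => a; rewrite rees_valB !rees_mapK // -rees_valB.
exact: Pgt_le (Pff' a).
Qed.

Lemma gr_map_class mu mu' alpha g : valuation_le mu mu' -> Pge mu alpha g ->
  gr_map mu' (gr_class mu alpha g) = gr_class mu' alpha g.
Proof.
move=> le Pg; rewrite gr_map_pi //; congr (\pi _); congr insubd.
rewrite -[LHS]/(\val _) val_insubd ifT //; apply/asboolP => a.
by rewrite ra_coef_single; case: eqP => [<-|_] //; left.
Qed.

Lemma gr_map_zmod_morphism mu mu' : valuation_le mu mu' ->
  zmod_morphism (@gr_map mu mu').
Proof.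
move=> le x y; rewrite -[x]reprK -[y]reprK -pi_GrB !gr_map_pi // -pi_GrB.
congr (\pi _); apply: val_inj; rewrite /= [in RHS]rees_mapK // [in RHS]rees_mapK //.
by rewrite -rees_valB rees_mapK.
Qed.

Lemma gr_map_monoid_morphism mu mu' : valuation_le mu mu' ->
  monoid_morphism (@gr_map mu mu').
Proof.
move=> le; split=> [|x y].
  rewrite -!pi_Gr1 gr_map_pi //; congr (\pi _); apply: val_inj.
  by rewrite [LHS]/= -[X in insubd _ X](rees_val1 mu) rees_mapK // !rees_val1.
rewrite -[x]reprK -[y]reprK -pi_GrM !gr_map_pi // -pi_GrM.
congr (\pi _); apply: val_inj; rewrite /= [in RHS]rees_mapK // [in RHS]rees_mapK //.
by rewrite -rees_valM rees_mapK.
Qed.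

(** * Key polynomials and augmentations *)

Definition mu_divides mu g h : Prop :=
  exists z : Gr mu, initial mu h = initial mu g * z.

Definition initial_ideal mu g : {pred Gr mu} :=
  [pred z | `[< exists w, z = initial mu g * w >]].

Arguments initial_ideal mu g : clear implicits.

Definition key_polynomial mu (phi : {poly K}) : Prop :=
  [/\ phi \is monic,
      exists2 z, z \in initial_ideal mu phi & z != 0,
      idealr_closed (initial_ideal mu phi),
      prime_idealr_closed (initial_ideal mu phi) &
      forall h, h != 0 -> (size h < size phi)%N -> ~ mu_divides mu phi h].

(* The coefficient a_s of the phi-expansion g = \sum_s a_s phi^s. *)
Definition phi_coef (phi g : {poly K}) (s : nat) : {poly K} :=
  (g %/ phi ^+ s) %% phi.

Lemma phi_expansion phi g : phi \is monic -> (1 < size phi)%N ->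
  g = \sum_(s < size g) phi_coef phi g s * phi ^+ s.
Proof.
move=> mphi sphi; have phi0 := monic_neq0 mphi.
have expand n : g = \sum_(s < n) phi_coef phi g s * phi ^+ s +
    (g %/ phi ^+ n) * phi ^+ n.
  elim: n => [|n IHn]; first by rewrite big_ord0 add0r expr0 divp1 mulr1.
  rewrite big_ord_recr /= -addrA {1}IHn; congr (_ + _).
  rewrite {1}(divp_eq (g %/ phi ^+ n) phi) mulrDl addrC; congr (_ + _).
  by rewrite divp_divl -exprSr -mulrA -exprS.
rewrite {1}(expand (size g)) divp_small ?mul0r ?addr0 //.
elim: (size g) => [|n IHn]; first by rewrite expr0 size_poly1.
rewrite exprS size_mul ?expf_neq0 //.
case: (size phi) sphi => [|[|m]] // _; rewrite !addSn /= ltnS.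
exact: leq_trans IHn (leq_addl m _).
Qed.

(* mu' = [mu; phi, nu] *)
Definition augmentation mu (phi : {poly K}) (nu : rat) (mu' : valuation v) :
    Prop :=
  forall g, g != 0 ->
    let val_at s := mu (phi_coef phi g s * phi ^+ s)%:F + s%:R * nu in
    (exists2 s, phi_coef phi g s != 0 & mu' g%:F = val_at s) /\
    forall s, phi_coef phi g s != 0 -> mu' g%:F <= val_at s.

(** * Newton polygons *)

Definition convex_hull (A : set (rat * rat)) : set (rat * rat) :=
  [set P | exists n (l : 'I_n -> rat) (Q : 'I_n -> rat * rat),
    [/\ forall i, 0 <= l i /\ A (Q i), \sum_i l i = 1,
        P.1 = \sum_i l i * (Q i).1 & P.2 = \sum_i l i * (Q i).2]].

Definition lower_convex_hull (A : set (rat * rat)) : set (rat * rat) :=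
  [set P | convex_hull A P /\
    forall y, convex_hull A (P.1, y) -> P.2 <= y].

Definition newton_polygon mu (phi g : {poly K}) : set (rat * rat) :=
  lower_convex_hull
    [set (s%:R, mu (phi_coef phi g s * phi ^+ s)%:F) |
      s in [set s : nat | phi_coef phi g s != 0]].

Definition slope_component (nu : rat) (N : set (rat * rat)) :
    set (rat * rat) :=
  [set P | N P /\ forall Q, N Q -> P.2 + nu * P.1 <= Q.2 + nu * Q.1].

Definition left_end (S : set (rat * rat)) : set (rat * rat) :=
  [set P | S P /\ forall Q, S Q -> P.1 <= Q.1].

End GradedMaps.

Arguments Delta {K v} mu _.
Arguments initial_ideal {K v} mu g _.

(** * MacLane chains *)

(* [chainS c phi nu mu] adds the step (phi, nu) to mu at the end of c. *)
Inductive chain (K : fieldType) (v : discrete_valuation K) :=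
| chain0
| chainS of chain v & {poly K} & rat & valuation v.

Arguments chain0 {K v}.

Section MacLaneChains.
Variables (K : fieldType) (v : discrete_valuation K).
Implicit Types (c : chain v) (g : {poly K}) (mu : valuation v).

(* For a chain of length r: mu_r, mu_{r-1}, phi_r and nu_r, with the
   conventions mu_{-1} = mu_0, phi_0 = x and nu_0 = 0. *)
Definition chain_val c : valuation v :=
  if c is chainS _ _ _ mu then mu else gauss v.
Definition chain_prev c : valuation v :=
  if c is chainS c' _ _ _ then chain_val c' else gauss v.
Definition chain_phi c : {poly K} :=
  if c is chainS _ phi _ _ then phi else 'X.
Definition chain_nu c : rat :=
  if c is chainS _ _ nu _ then nu else 0.

Fixpoint is_maclane c : Prop :=
  if c is chainS c' phi nu mu then
    [/\ is_maclane c', key_polynomial (chain_val c') phi, 0 < nu,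
        augmentation (chain_val c') phi nu mu &
        if c' is chain0 then True
        else ~ mu_divides (chain_val c') phi (chain_phi c')]
  else True.

Definition maclane_chain c mu : Prop := is_maclane c /\ chain_val c = mu.

Definition inductive_valuation mu : Prop := exists c, maclane_chain c mu.

Definition proper_key_polynomial mu (phi : {poly K}) : Prop :=
  key_polynomial mu phi /\
  exists2 c, maclane_chain c mu & ~ mu_divides mu phi (chain_phi c).

(* e_r, h_r, V_r and the pair (l_r, l'_r).  For a MacLane chain, the rational numbers whose numerators are taken in
   [chain_h] and [chain_V] are integers, and the division in [chain_e] is
   exact. *)
Definition chain_e c : nat :=
  (ramification (chain_val c) %/ ramification (chain_prev c))%N.
Definition chain_h c : int :=
  numq ((ramification (chain_val c))%:R * chain_nu c).
Definition chain_V c : int :=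
  numq ((ramification (chain_prev c))%:R * chain_prev c (chain_phi c)%:F).
Definition chain_l c : int * int :=
  xget (0, 0) [set l | l.1 * chain_h c + l.2 * (chain_e c)%:Z = 1 /\
                       0 <= l.1 < (chain_e c)%:Z].

Definition x_from_p c (p : Gr (chain_val c)) : Gr (chain_val c) :=
  initial (chain_val c) (chain_phi c) * p ^ (- chain_V c).

Variable pi : K.

Fixpoint chain_p c : Gr (chain_val c) :=
  match c with
  | chain0 => initial (gauss v) pi%:P
  | chainS c' phi nu mu =>
      gr_map mu (x_from_p (chain_p c')) ^ (chain_l c').1 *
      gr_map mu (chain_p c') ^ (chain_l c').2
  end.

Definition chain_x c : Gr (chain_val c) := x_from_p (chain_p c).

Definition chain_y c : Gr (chain_val c) :=
  chain_x c ^+ chain_e c * chain_p c ^ (- chain_h c).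

Definition chain_newton c g : set (rat * rat) :=
  newton_polygon (chain_prev c) (chain_phi c) g.

(* The field F_r as a subset of Delta_r. *)
Definition chain_field c : set (Gr (chain_val c)) :=
  match c return set (Gr (chain_val c)) with
  | chain0 => [set gr_class (gauss v) 0 a%:P | a in valuation_ring v]
  | chainS c' _ _ mu => @gr_map _ _ _ mu @` Delta (chain_val c')
  end.

Arguments chain_field c : clear implicits.

(* The pair (s_r(g), u_r(g)). *)
Definition chain_su c g : nat * int :=
  xget (0%N, 0) [set su |
    if c is chain0 then su.1 = 0%N /\ su.2%:~R = gauss v g%:F
    else left_end (slope_component (chain_nu c) (chain_newton c g))
           (su.1%:R, su.2%:~R / (ramification (chain_prev c))%:R)].

Definition is_residual c g (R : {poly Gr (chain_val c)}) : Prop :=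
  (forall k, chain_field c R`_k) /\
  initial (chain_val c) g =
    chain_x c ^+ (chain_su c g).1 * chain_p c ^ (chain_su c g).2 *
    R.[chain_y c].

Definition residual c g : {poly Gr (chain_val c)} :=
  if g == 0 then 0 else xget 0 [set R | is_residual g R].

End MacLaneChains.

Arguments chain_field {K v} c _.

(* Main.v *)
(** Write p_(r+1) = H(phi_r)^l p_r^l'', where l N + l'' e_r = 1 with
N = e(mu_r) mu_r(phi_r) and 0 <= l < e_r; the number V_r no longer matters.
If e_r = 1 then l = 0 and p_(r+1) = p_r, so such a step has no effect.  If
e_r > 1, the values of mu on the polynomials of degree less than deg phi_r form
the value group of mu_(r-1), which does not contain mu(phi_r).  Hence phi_r has
the largest value among the monic polynomials of its degree, and all those with
the same value have the same initial form.  In two chains of mu, the last steps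
with e > 1 thus have the same degree, the same value and the same initial form,
and the preceding valuations have the same ramification index: induction on the
two chains gives the equality of the p_(r+1), on which x_(r+1), y_(r+1) and
R_(r+1) depend. *)
Require Import Defs.
From mathcomp Require Import all_boot all_order all_algebra.
From mathcomp Require Import boolp classical_sets ring zify.

Set Implicit Arguments.
Unset Strict Implicit.
Unset Printing Implicit Defensive.

Import Order.TTheory GRing.Theory Num.Theory.

Local Open Scope ring_scope.
Local Open Scope quotient_scope.

(** * Initial forms and maps of graded algebras *)

Section Initial.
Variables (K : fieldType) (v : discrete_valuation K).
Implicit Types (mu : valuation v) (g h : {poly K}).

Lemma pval1 mu : mu 1%:F = 0. Proof. by rewrite tofrac1 kval1. Qed.

Lemma pvalM mu g h : g != 0 -> h != 0 -> mu (g * h)%:F = mu g%:F + mu h%:F.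
Proof. by move=> g0 h0; rewrite tofracM kvalM ?tofrac_eq0. Qed.

Lemma pvalX mu g n : g != 0 -> mu (g ^+ n)%:F = n%:R * mu g%:F.
Proof.
move=> g0; elim: n => [|n IHn]; first by rewrite expr0 pval1 mul0r.
by rewrite exprS pvalM ?expf_neq0 // IHn -natr1 mulrDl mul1r addrC.
Qed.

Lemma pvalN mu g : mu (- g)%:F = mu g%:F.
Proof.
have [->|g0] := eqVneq g 0; first by rewrite oppr0.
by rewrite tofracN kvalN ?tofrac_eq0.
Qed.

Lemma Pge_refl mu g : Pge mu (mu g%:F) g. Proof. by right. Qed.

Lemma Pgt_Pge mu al g : Pgt mu al g -> Pge mu al g.
Proof. by case=> [->|/ltW]; [left|right]. Qed.

Lemma Pge_trans mu al be g : al <= be -> Pge mu be g -> Pge mu al g.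
Proof. by move=> le [->|/(le_trans le)]; [left|right]. Qed.

Lemma pval_ge mu g (al : rat) : g != 0 -> Pge mu al g -> al <= mu g%:F.
Proof. by move=> g0 [/eqP|//]; rewrite (negPf g0). Qed.

Lemma pval_gt mu g (al : rat) : g != 0 -> Pgt mu al g -> al < mu g%:F.
Proof. by move=> g0 [/eqP|//]; rewrite (negPf g0). Qed.

Lemma rees_single mu al g : Pge mu al g ->
  rees_val (insubd (0 : rees mu) (ra_single al g)) = ra_single al g.
Proof.
move=> Pg; rewrite -[LHS]/(\val _) val_insubd ifT //; apply/asboolP => a.
by rewrite ra_coef_single; case: eqP => [<-|_] //; left.
Qed.

Lemma gr_classM mu al be g h : Pge mu al g -> Pge mu be h ->
  gr_class mu al g * gr_class mu be h = gr_class mu (al + be) (g * h).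
Proof.
move=> Pg Ph; rewrite /gr_class -pi_GrM; congr (\pi _); apply: val_inj.
rewrite /= !rees_single //; first exact: ra_mul_single.
exact: PgeM.
Qed.

Lemma gr_classB mu al g h : Pge mu al g -> Pge mu al h ->
  gr_class mu al (g - h) = gr_class mu al g - gr_class mu al h.
Proof.
move=> Pg Ph; rewrite /gr_class -pi_GrB; congr (\pi _); apply: val_inj.
rewrite [RHS]rees_valB [LHS]/= !rees_single //; first by
  apply/eqP; rewrite eq_sym subr_eq -ra_singleD subrK.
by apply: PgeD => //; apply: PgeN.
Qed.

Lemma gr_class_eq mu al g h : Pge mu al g -> Pgt mu al (g - h) ->
  gr_class mu al g = gr_class mu al h.
Proof.
move=> Pg Pgh; have Ph : Pge mu al h.
  by rewrite -[h](subKr g); apply: PgeD => //; apply/PgeN/Pgt_Pge.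
apply/eqP; rewrite -subr_eq0 -gr_classB //; apply/eqP/gr_class_eq0 => //.
exact: Pgt_Pge.
Qed.

Lemma initialM mu g h : g != 0 -> h != 0 ->
  initial mu (g * h) = initial mu g * initial mu h.
Proof.
by move=> g0 h0; rewrite /initial gr_classM ?pvalM //; apply: Pge_refl.
Qed.

Lemma initial1 mu : initial mu 1 = 1.
Proof.
rewrite /initial pval1 -pi_Gr1; congr (\pi _); apply: val_inj.
rewrite /= rees_single ?rees_val1 //; right; by rewrite pval1.
Qed.

(** If g + h vanished or had value above mu(g), then g = (g + h) - h would have value above its own.
    The difference of g + h and g is h, which is zero in degree mu(g). *)
Lemma val_dominated mu g h : g != 0 -> Pgt mu (mu g%:F) h ->
  [/\ g + h != 0, mu (g + h)%:F = mu g%:F & initial mu (g + h) = initial mu g].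
Proof.
move=> g0 lt_h; have gh0 : g + h != 0.
  apply/eqP => /eqP; rewrite addr_eq0 => /eqP gh.
  have : Pgt mu (mu g%:F) g by rewrite [X in Pgt _ _ X]gh; apply: PgtN.
  by move/(pval_gt g0); rewrite ltxx.
have ghE : mu (g + h)%:F = mu g%:F.
  apply/eqP; rewrite eq_le (pval_ge gh0) ?andbT; last first.
    by apply: PgeD (Pge_refl _ _) (Pgt_Pge lt_h).
  rewrite leNgt; apply/negP => lt_gh.
  have : Pgt mu (mu g%:F) g.
    by rewrite -[X in Pgt _ _ X](addrK h); apply: PgtD (PgtN lt_h); right.
  by move/(pval_gt g0); rewrite ltxx.
split=> //; rewrite /initial ghE; apply: gr_class_eq.
  by right; rewrite ghE.
by rewrite addrC addKr.
Qed.

End Initial.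

(** * Transport of units and initial forms along mu <= mu' *)

Section GrMap.
Variables (K : fieldType) (v : discrete_valuation K) (mu mu' : valuation v).
Hypothesis le : valuation_le mu mu'.
Implicit Types (g h : {poly K}) (z : Gr mu).

Lemma gr_map1 : gr_map mu' (1 : Gr mu) = 1.
Proof. by case: (gr_map_monoid_morphism le). Qed.

Lemma gr_mapM z t : gr_map mu' (z * t) = gr_map mu' z * gr_map mu' t.
Proof. by case: (gr_map_monoid_morphism le) => _ ->. Qed.

Lemma gr_mapXn z n : gr_map mu' (z ^+ n) = gr_map mu' z ^+ n.
Proof.
by elim: n => [|n IHn]; rewrite ?gr_map1 // !exprS gr_mapM IHn.
Qed.

Lemma gr_map_unit z : z \is a GRing.unit -> gr_map mu' z \is a GRing.unit.
Proof.
move=> uz; apply/unitrPr; exists (gr_map mu' z^-1).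
by rewrite -gr_mapM divrr ?gr_map1.
Qed.

Lemma gr_mapV z : z \is a GRing.unit -> gr_map mu' z^-1 = (gr_map mu' z)^-1.
Proof.
move=> uz; apply: (mulrI (gr_map_unit uz)).
by rewrite -gr_mapM !divrr ?gr_map_unit ?gr_map1.
Qed.

Lemma gr_mapXz z (n : int) :
  z \is a GRing.unit -> gr_map mu' (z ^ n) = gr_map mu' z ^ n.
Proof.
case: n => n uz; first exact: gr_mapXn.
by rewrite /exprz gr_mapV ?unitrX // gr_mapXn.
Qed.

Lemma gr_map_monomial x z n (k : int) : z \is a GRing.unit ->
  gr_map mu' (x ^+ n * z ^ k) = gr_map mu' x ^+ n * gr_map mu' z ^ k.
Proof. by move=> uz; rewrite gr_mapM gr_mapXn gr_mapXz. Qed.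

Lemma gr_map_initial g : mu' g%:F = mu g%:F ->
  gr_map mu' (initial mu g) = initial mu' g.
Proof. by move=> E; rewrite gr_map_class ?/initial ?E //; apply: Pge_refl. Qed.

Lemma gr_map_initial_Xz g z (k : int) : mu' g%:F = mu g%:F ->
  z \is a GRing.unit ->
  gr_map mu' (initial mu g * z ^ k) = initial mu' g * gr_map mu' z ^ k.
Proof. by move=> E uz; rewrite gr_mapM gr_map_initial // gr_mapXz. Qed.

(** If g gained value, [gr_map] would send its initial form to 0, which is impossible for a unit. *)
Lemma val_unit g : g != 0 -> initial mu g \is a GRing.unit ->
  mu' g%:F = mu g%:F.
Proof.
move=> g0 /gr_map_unit; rewrite gr_map_class //; last exact: Pge_refl.
move=> U; apply/eqP; rewrite eq_le le // andbT leNgt; apply/negP => lt.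
suff : gr_class mu' (mu g%:F) g = 0 by move=> E; rewrite E unitr0 in U.
by apply/(gr_class_eq0 (or_intror (ltW lt))); right.
Qed.

End GrMap.

Lemma gr_map_comp (K : fieldType) (v : discrete_valuation K)
    (mu1 mu2 mu3 : valuation v) (z : Gr mu1) :
  valuation_le mu1 mu2 -> valuation_le mu2 mu3 -> valuation_le mu1 mu3 ->
  gr_map mu3 (gr_map mu2 z) = gr_map mu3 z.
Proof.
move=> le12 le23 le13; rewrite -[z]reprK (gr_map_pi _ le12) !gr_map_pi //.
congr (\pi _).
by rewrite rees_mapK.
Qed.

(** * Key polynomials and augmentations *)

Section KeyPolynomial.
Variables (K : fieldType) (v : discrete_valuation K) (mu : valuation v).
Variables (phi : {poly K}) (key : key_polynomial mu phi).
Implicit Types (a b g h : {poly K}).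

Lemma key_monic : phi \is monic. Proof. by case: key. Qed.

Lemma key_neq0 : phi != 0. Proof. exact: monic_neq0 key_monic. Qed.

Lemma key_ndiv_small a : a != 0 -> (size a < size phi)%N ->
  ~ mu_divides mu phi a.
Proof. by case: key => _ _ _ _; apply. Qed.

(** A prime ideal is proper: dividing a unit would put 1 into the ideal generated by the initial
    form of phi. *)
Lemma key_ndiv_unit g : initial mu g \is a GRing.unit -> ~ mu_divides mu phi g.
Proof.
case: key => _ _ [_ /negP n1 _] _ _ ug [z gE]; apply: n1; apply/asboolP.
by exists (z * (initial mu g)^-1); rewrite mulrA -gE divrr.
Qed.

Lemma key_size_gt1 : (1 < size phi)%N.
Proof.
rewrite ltnNge; apply/negP => /size1_polyC phiE; have := key_monic.
rewrite phiE monicE lead_coefC => /eqP c1; apply: (@key_ndiv_unit phi).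
  by rewrite phiE c1 initial1 unitr1.
by exists 1; rewrite mulr1.
Qed.

Lemma size_key_exp n : (size phi <= size (phi ^+ n.+1))%N.
Proof.
by apply: dvdp_leq; rewrite ?expf_neq0 ?key_neq0 // exprS dvdp_mulr.
Qed.

Lemma key_ndivM g h : g != 0 -> h != 0 ->
  ~ mu_divides mu phi g -> ~ mu_divides mu phi h -> ~ mu_divides mu phi (g * h).
Proof.
move=> g0 h0 ng nh dgh; case: key => _ _ _ pr _.
have : initial mu g * initial mu h \in initial_ideal mu phi.
  by rewrite -initialM //; apply/asboolP.
by move/pr/orP => [] /asboolP.
Qed.

(** If the remainder a had value below mu(g), then -a and g - a, a multiple of phi, would share
    their initial form, so phi would divide -a, of degree less than deg phi. *)
Lemma val_modp g : g != 0 -> Pge mu (mu g%:F) (g %% phi).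
Proof.
move=> g0; have [->|a0] := eqVneq (g %% phi) 0; [by left|right].
rewrite leNgt; apply/negP => lt; set a := g %% phi in a0 lt.
have na0 : - a != 0 by rewrite oppr_eq0.
have [b0 _ bE] : [/\ - a + g != 0, mu (- a + g)%:F = mu (- a)%:F
    & initial mu (- a + g) = initial mu (- a)].
  by apply: val_dominated => //; right; rewrite pvalN.
have bqE : - a + g = phi * (g %/ phi).
  by rewrite {1}(divp_eq g phi) addrC addrK mulrC.
apply: (@key_ndiv_small (- a)); rewrite ?size_polyN ?ltn_modp ?key_neq0 //.
exists (initial mu (g %/ phi)); rewrite -bE bqE initialM ?key_neq0 //.
by move: b0; rewrite bqE mulf_eq0 negb_or => /andP[].
Qed.

Lemma val_divp g : g != 0 -> Pge mu (mu g%:F) (g %/ phi * phi).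
Proof.
move=> g0; rewrite -[X in Pge _ _ X](addrK (g %% phi)) -divp_eq.
by apply: PgeD (Pge_refl _ _) (PgeN (val_modp g0)).
Qed.

(** If the remainder had larger value, g would have the same initial form as a multiple of phi. *)
Lemma ndiv_modp g : g != 0 -> ~ mu_divides mu phi g ->
  g %% phi != 0 /\ mu (g %% phi)%:F = mu g%:F.
Proof.
move=> g0 ng; have : ~ Pgt mu (mu g%:F) (g %% phi).
  move=> /PgtN lt; apply: ng; have [b0 _ bE] := val_dominated g0 lt.
  have bqE : g - g %% phi = phi * (g %/ phi).
    by rewrite {1}(divp_eq g phi) addrK mulrC.
  exists (initial mu (g %/ phi)); rewrite -bE bqE initialM ?key_neq0 //.
  by move: b0; rewrite bqE mulf_eq0 negb_or => /andP[].
move=> nlt; have a0 : g %% phi != 0 by apply/eqP => a0; apply: nlt; left.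
split=> //; apply/eqP; rewrite eq_le (pval_ge a0 (val_modp g0)) andbT leNgt.
by apply/negP => lt; apply: nlt; right.
Qed.

(** * Values and initial forms after one augmentation *)

Section Augmentation.
Variables (nu : rat) (mu' : valuation v).
Hypotheses (nu_gt0 : 0 < nu) (aug : augmentation mu phi nu mu').

Lemma phi_coef_small a s : (size a < size phi)%N ->
  phi_coef phi a s = if s == 0%N then a else 0.
Proof.
move=> lt; rewrite /phi_coef; case: s => [|s].
  by rewrite expr0 divp1 modp_small.
by rewrite divp_small ?mod0p // (leq_trans lt) // size_key_exp.
Qed.

Lemma aug_small a : a != 0 -> (size a < size phi)%N -> mu' a%:F = mu a%:F.
Proof.
move=> a0 lt; have [[s]] := aug a0.
rewrite phi_coef_small //; case: s => [|s] /=; last by rewrite eqxx.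
by rewrite expr0 mulr1 mul0r addr0.
Qed.

Lemma aug_phi : mu' phi%:F = mu phi%:F + nu.
Proof.
have [[s]] := aug key_neq0; rewrite /phi_coef.
case: s => [|[|s]] /=; first by rewrite expr0 divp1 modpp eqxx.
  rewrite expr1 divpp ?key_neq0 // modp_small ?mul1r //.
  by rewrite size_poly1 key_size_gt1.
rewrite divp_small ?mod0p ?eqxx // exprS size_mul ?expf_neq0 ?key_neq0 //.
have := leq_trans key_size_gt1 (size_key_exp s).
case: (size (phi ^+ _)) => [|[|n]] // _.
by rewrite !addnS /= ltnS leq_addr.
Qed.

Lemma val_divp_exp g s : g != 0 -> Pge mu (mu g%:F) (g %/ phi ^+ s * phi ^+ s).
Proof.
move=> g0; elim: s => [|s IHs].
  by rewrite expr0 divp1 mulr1; apply: Pge_refl.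
have [h0|h0] := eqVneq (g %/ phi ^+ s) 0.
  by rewrite exprSr -divp_divl h0 div0p mul0r; left.
have phis0 : phi ^+ s != 0 by rewrite expf_neq0 ?key_neq0.
rewrite [in _ %/ _]exprSr -divp_divl exprS mulrA.
apply: (@Pge_trans _ _ _ _ (mu (g %/ phi ^+ s)%:F + mu (phi ^+ s)%:F)).
  by rewrite -pvalM //; apply: pval_ge IHs; rewrite mulf_neq0.
by apply: PgeM (Pge_refl _ _); apply: val_divp.
Qed.

Lemma val_phi_coef g s : g != 0 ->
  Pge mu (mu g%:F) (phi_coef phi g s * phi ^+ s).
Proof.
move=> g0; rewrite /phi_coef; have [->|h0] := eqVneq (g %/ phi ^+ s) 0.
  by rewrite mod0p mul0r; left.
have phis0 : phi ^+ s != 0 by rewrite expf_neq0 ?key_neq0.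
apply: (@Pge_trans _ _ _ _ (mu (g %/ phi ^+ s)%:F + mu (phi ^+ s)%:F)).
  by rewrite -pvalM //; apply: pval_ge (val_divp_exp s g0); rewrite mulf_neq0.
by apply: PgeM (Pge_refl _ _); apply: val_modp.
Qed.

(** Each term of the phi-expansion has mu-value at least mu(g), and the correction s nu is
    nonnegative. *)
Lemma aug_le : valuation_le mu mu'.
Proof.
move=> g g0; have [[s as0 ->] _] := aug g0.
apply: (@le_trans _ _ (mu (phi_coef phi g s * phi ^+ s)%:F)).
  by apply: pval_ge (val_phi_coef s g0); rewrite mulf_neq0 ?expf_neq0 ?key_neq0.
by rewrite lerDl mulr_ge0 ?ler0n // ltW.
Qed.

Lemma aug_expand g : g != 0 -> exists a (s : nat),
  [/\ a != 0, (size a < size phi)%N & mu' g%:F = mu' a%:F + s%:R * mu' phi%:F].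
Proof.
move=> g0; have [[s as0 ->] _] := aug g0; exists (phi_coef phi g s), s.
have lt : (size (phi_coef phi g s) < size phi)%N by rewrite ltn_modp key_neq0.
split=> //; rewrite aug_small // aug_phi pvalM ?expf_neq0 ?key_neq0 //.
by rewrite pvalX ?key_neq0 // mulrDr addrA.
Qed.

(** In g = q phi + a the term q phi has mu-value at least mu(g) = mu(a) and gains at least nu > 0,
    so a dominates for mu'. *)
Lemma aug_ndiv g : g != 0 -> ~ mu_divides mu phi g ->
  [/\ g %% phi != 0, mu' g%:F = mu g%:F, mu' (g %% phi)%:F = mu g%:F
    & initial mu' g = initial mu' (g %% phi)].
Proof.
move=> g0 ng; have [a0 aE] := ndiv_modp g0 ng.
have lt : (size (g %% phi)%R < size phi)%N by rewrite ltn_modp key_neq0.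
have a'E : mu' (g %% phi)%:F = mu g%:F by rewrite aug_small.
have Pq : Pgt mu' (mu' (g %% phi)%:F) (g %/ phi * phi).
  rewrite a'E; case: (val_divp g0) => [->|le]; first by left.
  have [->|q0] := eqVneq (g %/ phi) 0; first by rewrite mul0r; left.
  right; apply: (le_lt_trans le); rewrite !pvalM ?key_neq0 // aug_phi.
  by rewrite ler_ltD ?aug_le // ltrDl.
by have [] := val_dominated a0 Pq; rewrite addrC -divp_eq a'E.
Qed.

(** By primality phi does not divide ab, so [aug_ndiv] applies to ab: modulo higher values,
    polynomials of degree less than deg phi multiply as residues modulo phi. *)
Lemma aug_mulmod a b : a != 0 -> b != 0 ->
  (size a < size phi)%N -> (size b < size phi)%N ->
  [/\ (a * b) %% phi != 0,
      mu' ((a * b) %% phi)%:F = mu' a%:F + mu' b%:F &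
      initial mu' a * initial mu' b = initial mu' ((a * b) %% phi)].
Proof.
move=> a0 b0 lta ltb; have ab0 := mulf_neq0 a0 b0.
have nab : ~ mu_divides mu phi (a * b).
  by apply: key_ndivM => //; apply: key_ndiv_small.
have [c0 abE cE abI] := aug_ndiv ab0 nab.
by split=> //; rewrite -?initialM // cE -abE pvalM.
Qed.

Lemma aug_inverse a : a != 0 -> (size a < size phi)%N ->
  exists b, [/\ b != 0, (size b < size phi)%N, mu' b%:F = - mu' a%:F &
    initial mu' a * initial mu' b = 1].
Proof.
move=> a0 lta.
(* A nonconstant common divisor d would give phi = e d with both degrees below deg phi, so phi would
   divide neither factor but divide their product. *)
have cop : coprimep a phi.
  apply/coprimepP => d da dphi; rewrite -size_poly_eq1.
  have d0 : d != 0.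
    by apply: contra_neq a0 => d0; move: da; rewrite d0 dvd0p => /eqP.
  have ltd : (size d < size phi)%N := leq_ltn_trans (dvdp_leq a0 da) lta.
  have /esym dE := divpK dphi; set e := phi %/ d in dE.
  have e0 : e != 0 by apply: contra_neq key_neq0 => e0; rewrite dE e0 mul0r.
  rewrite eqn_leq size_poly_gt0 d0 andbT leqNgt; apply/negP => gt1.
  have lte : (size e < size phi)%N.
    rewrite dE size_mul //; case: (size d) gt1 => [|[|n]] // _.
    by rewrite !addnS /= ltnS leq_addr.
  have := key_ndivM e0 d0 (key_ndiv_small e0 lte) (key_ndiv_small d0 ltd).
  by rewrite -dE; apply; exists 1; rewrite mulr1.
(* With u a + w phi = 1, the witness is u reduced modulo phi. *)
have /Bezout_eq1_coprimepP[[u w] /= uwE] := cop.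
have ub1 : (a * (u %% phi)) %% phi = 1.
  rewrite modp_mul mulrC -[u * a](addrK (w * phi)) uwE modpD modpN modp_mull.
  by rewrite subr0 modp_small // size_poly1 key_size_gt1.
have b0 : u %% phi != 0.
  by apply: contra_eq_neq ub1 => ->; rewrite mulr0 mod0p eq_sym oner_neq0.
have ltb : (size (u %% phi)%R < size phi)%N by rewrite ltn_modp key_neq0.
exists (u %% phi); have [_] := aug_mulmod a0 b0 lta ltb.
rewrite ub1 pval1 initial1 => /esym/eqP; rewrite addr_eq0 => /eqP -> ->.
by split=> //; rewrite opprK.
Qed.

Lemma aug_unit a : a != 0 -> (size a < size phi)%N ->
  initial mu' a \is a GRing.unit.
Proof.
move=> a0 lt; have [b [_ _ _ ab]] := aug_inverse a0 lt.
by apply/unitrPr; exists (initial mu' b).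
Qed.

Lemma aug_ndiv_unit g : g != 0 -> ~ mu_divides mu phi g ->
  initial mu' g \is a GRing.unit.
Proof.
move=> g0 /(aug_ndiv g0) [a0 _ _ ->]; apply: aug_unit => //.
by rewrite ltn_modp key_neq0.
Qed.

End Augmentation.
End KeyPolynomial.

(** * Value groups and ramification indices *)

(* Stated for an abstract field because computing in {fraction _} is slow. *)
Section Multiplicative.
Variables (L : fieldType) (A : numDomainType) (w : L -> A).
Hypothesis wM : forall a b, a != 0 -> b != 0 -> w (a * b) = w a + w b.

Lemma mult_quot f d n : f != 0 -> d != 0 -> f * d = n -> w f = w n - w d.
Proof. by move=> f0 d0 <-; rewrite wM // addrK. Qed.

Lemma mult_imageB al be : (w @` [set f | f != 0])%classic al ->
  (w @` [set f | f != 0])%classic be ->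
  (w @` [set f | f != 0])%classic (al - be).
Proof.
move=> [f /= f0 <-] [g /= g0 <-]; have q0 : f / g != 0.
  by rewrite mulf_neq0 ?invr_eq0.
by exists (f / g) => //; apply: mult_quot; rewrite ?divfK.
Qed.

End Multiplicative.

Section ValueGroup.
Variables (K : fieldType) (v : discrete_valuation K) (mu : valuation v).
Implicit Types (al be : rat).

Lemma value_group_poly (g : {poly K}) : g != 0 -> value_group mu (mu g%:F).
Proof. by move=> g0; exists g%:F => //; rewrite /= tofrac_eq0. Qed.

Lemma value_groupB al be :
  value_group mu al -> value_group mu be -> value_group mu (al - be).
Proof. exact: (mult_imageB (@kvalM _ _ mu)). Qed.

Lemma value_group0 : value_group mu 0.
Proof. by rewrite -(pval1 mu); apply: value_group_poly; rewrite oner_neq0. Qed.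

Lemma value_groupD al be :
  value_group mu al -> value_group mu be -> value_group mu (al + be).
Proof.
move=> Gal Gbe; rewrite -[be]opprK; apply: value_groupB => //.
by rewrite -[- be]add0r; apply: value_groupB => //; apply: value_group0.
Qed.

Lemma value_groupMz (k : int) al :
  value_group mu al -> value_group mu (k%:~R * al).
Proof.
move=> Gal; have Gn (n : nat) : value_group mu (n%:R * al).
  elim: n => [|n IHn]; first by rewrite mul0r; apply: value_group0.
  by rewrite -natr1 mulrDl mul1r; apply: value_groupD.
case: k => n; first exact: Gn.
rewrite NegzE intrN mulNr -[- _]add0r.
exact: value_groupB value_group0 (Gn _).
Qed.

(** Nonzero elements of K(x) are quotients of nonzero polynomials, so every value is a difference of
    values of polynomials. *)
Lemma value_group_ind (P : rat -> Prop) :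
  (forall al be, P al -> P be -> P (al - be)) ->
  (forall g : {poly K}, g != 0 -> P (mu g%:F)) ->
  forall al, value_group mu al -> P al.
Proof.
move=> PB Pg al [f /= f0 <-]; have d0 := denom_ratioP (repr f).
have n0 := frac_repr_neq0 f0.
have d0' : (\d_(repr f))%:F != 0 by rewrite tofrac_eq0.
rewrite (mult_quot (@kvalM _ _ mu) f0 d0' (frac_repr f)).
by apply: PB; apply: Pg.
Qed.

(** Says that the value group is (1/E) Z. As [ramification] has a default value, this property must
    be established along each chain. *)
Definition value_group_index (E : nat) : Prop :=
  (0 < E)%N /\ forall al, value_group mu al <-> E%:R * al \is a Num.int.

Lemma ramificationE E : value_group_index E -> ramification mu = E.
Proof.
move=> [E0 GE]; have E0' : E%:R != 0 :> rat by rewrite pnatr_eq0 -lt0n.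
apply: xget_unique => [|d [d0 dG]].
  split=> //; rewrite eqEsubset; split=> [_ [al Gal <-]|_ [k _ <-]].
    by have /intrP[k ->] := (GE al).1 Gal; exists k.
  exists (k%:~R / E%:R); last by rewrite mulrC divfK.
  by apply/GE; rewrite mulrC divfK // intr_int.
have d0' : d%:R != 0 :> rat by rewrite pnatr_eq0 -lt0n.
(* Two indices divide each other: d al = 1 and E al = k give E = k d, and d/E = m gives d = m E. *)
have [al /GE/intrP[k alE] ale] : (image (value_group mu) (fun a => d%:R * a)) 1.
  by rewrite dG; exists 1.
have [m _ mE] : (range (intr : int -> rat)) (d%:R / E%:R).
  by rewrite -dG; exists E%:R^-1 => //; apply/GE; rewrite mulfV ?rpred1.
apply/eqP; rewrite eqn_dvd; apply/andP; split.
  suff: (d%:Z %| E%:Z)%Z by [].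
  apply/dvdzP; exists k; apply/eqP; rewrite -(eqr_int rat) intrM -alE.
  by rewrite -[X in _ * X]/(d%:R) mulrAC -mulrA ale mulr1.
suff: (E%:Z %| d%:Z)%Z by [].
apply/dvdzP; exists m; apply/eqP; rewrite -(eqr_int rat) intrM mE.
by rewrite divfK.
Qed.

End ValueGroup.

Lemma gauss_index (K : fieldType) (v : discrete_valuation K) :
  value_group_index (gauss v) 1.
Proof.
split=> // al; rewrite mul1r; split.
  move: al; apply: value_group_ind => [al be|g g0]; first exact: rpredB.
  by rewrite /= gauss_fun_poly // intr_int.
move=> /intrP[k ->]; have [a a0 <-] := dval_surj v k.
rewrite -(kval_base (gauss v) a0).
by apply: value_group_poly; rewrite polyC_eq0.
Qed.

(** * The value group of an augmented valuation *)

Section AugmentationIndex.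
Variables (K : fieldType) (v : discrete_valuation K) (mu : valuation v).
Variables (phi : {poly K}) (key : key_polynomial mu phi).
Variables (nu : rat) (mu' : valuation v).
Hypotheses (nu_gt0 : 0 < nu) (aug : augmentation mu phi nu mu').

Definition small_value (al : rat) : Prop :=
  exists a : {poly K}, [/\ a != 0, (size a < size phi)%N & mu' a%:F = al].

(** Subtracting a value means multiplying by the inverse modulo phi and reducing; hence the small
    values form a group. *)
Lemma small_valueB al be :
  small_value al -> small_value be -> small_value (al - be).
Proof.
move=> [a [a0 lta <-]] [b [b0 ltb <-]].
have [c [c0 ltc <- _]] := aug_inverse key nu_gt0 aug b0 ltb.
have [d0 <- _] := aug_mulmod key nu_gt0 aug a0 c0 lta ltc.
by exists (a * c %% phi); rewrite ltn_modp (key_neq0 key).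
Qed.

Lemma small_value_ndiv g : g != 0 -> ~ mu_divides mu phi g ->
  small_value (mu g%:F).
Proof.
move=> g0 ng; have [a0 _ aE _] := aug_ndiv key nu_gt0 aug g0 ng.
by exists (g %% phi); rewrite ltn_modp (key_neq0 key).
Qed.

Hypothesis small : forall al, value_group mu al -> small_value al.

(** The value group of mu' is generated by (1/E) Z and nu. If E nu = a/b in lowest terms, this is
    (1/(E b)) Z. Hypothesis [small] puts the value group of mu inside that of mu'. *)
Lemma augmentation_index E : value_group_index mu E ->
  value_group_index mu' (E * `|denq (E%:R * nu)|).
Proof.
move=> [E0 GE]; set b := `|_|%N; set a := numq (E%:R * nu).
have b0 : (0 < b)%N by rewrite absz_gt0 denq_neq0.
have bE : (b%:R : rat) = (denq (E%:R * nu))%:~R by rewrite -absz_denq.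
have aE : b%:R * (E%:R * nu) = a%:~R.
  by rewrite bE mulrC -numqE.
split; first by rewrite muln_gt0 E0.
have Gsmall al : small_value al -> value_group mu' al.
  by move=> [c [c0 _ <-]]; apply: value_group_poly.
move=> al; split.
  move: al; apply: value_group_ind => [al be|g g0].
    by rewrite mulrBr; apply: rpredB.
  have [c [s [c0 ltc ->]]] := aug_expand key aug g0.
  rewrite (aug_small key aug) // (aug_phi key aug) mulrDr natrM.
  have inE h : h != 0 -> E%:R * b%:R * mu h%:F \is a Num.int.
    move=> h0; rewrite mulrAC rpredM ?rpred_nat //.
    exact: (GE _).1 (value_group_poly mu h0).
  rewrite rpredD ?inE // mulrCA rpredM ?rpred_nat // mulrDr.
  rewrite rpredD ?inE ?(key_neq0 key) //.
  by rewrite -mulrA mulrCA aE intr_int.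
have cop : coprimez a b.
  by rewrite coprimezE absz_nat coprime_num_den.
have /coprimezP[[l l'] /= ll1] := cop.
move=> /intrP[k]; rewrite natrM => kE.
have E0' : E%:R != 0 :> rat by rewrite pnatr_eq0 -lt0n.
have b0' : b%:R != 0 :> rat by rewrite pnatr_eq0 -lt0n.
have ll1' : l%:~R * (b%:R * (E%:R * nu)) + l'%:~R * b%:R = 1 :> rat.
  by rewrite aE -(intrM rat l) -(intrM rat l' b) -intrD ll1.
(* Here al = k/(E b), and l a + l' b = 1 splits it into a multiple of nu and one of 1/E; below, nu
   is obtained as mu'(phi) - mu(phi). *)
have -> : al = (k * l)%:~R * nu + (k * l')%:~R * E%:R^-1.
  apply: (mulfI (mulf_neq0 E0' b0')); rewrite kE !intrM.
  have /= := congr1 (fun x => k%:~R * x) ll1'; rewrite mulr1 => kl.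
  by rewrite -[LHS]kl; field.
apply: value_groupD; apply: value_groupMz.
  rewrite -[nu](addKr (mu phi%:F)) -(aug_phi key aug) addrC.
  apply: value_groupB; first exact: value_group_poly (key_neq0 key).
  by apply/Gsmall/small/value_group_poly; exact: key_neq0 key.
by apply/Gsmall/small/GE; rewrite mulfV ?rpred1.
Qed.

End AugmentationIndex.

(** * Numerical data of a MacLane chain *)

Section Chains.
Variables (K : fieldType) (v : discrete_valuation K).
Implicit Types (c : chain v) (mu : valuation v) (phi g : {poly K}).

(** For the Gauss valuation constants already take every value. Otherwise values are generated by
    those of polynomials of degree less than deg phi' and that of phi'; phi divides none of these,
    so each has the value of its remainder modulo phi. *)
Lemma chain_small c phi nu mu : is_maclane (chainS c phi nu mu) ->
  forall al, value_group (chain_val c) al -> small_value phi mu al.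
Proof.
move=> /= [mc key nu0 aug nd]; apply: value_group_ind => [|g g0].
  by move=> al be; apply: (small_valueB key nu0 aug).
case: c mc key aug nd => [|c' phi' nu' mu'] /= mc key aug nd.
  rewrite gauss_fun_poly //; have [a a0 <-] := dval_surj v (gauss_poly v g).
  have aP0 : a%:P != 0 by rewrite polyC_eq0.
  have lt : (size a%:P < size phi)%N.
    exact: leq_ltn_trans (size_polyC_leq1 a) (key_size_gt1 key).
  by exists a%:P; split=> //; rewrite (aug_small key aug) // kval_base.
case: mc => mc' key' nu'0 aug' _.
have [a [s [a0 lt ->]]] := aug_expand key' aug' g0.
(* The chain condition that phi does not divide the previous key polynomial enters here. *)
have Sphi : small_value phi mu (mu' phi'%:F).
  by apply: (small_value_ndiv key nu0 aug) => //; apply: key_neq0 key'.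
have Sn : small_value phi mu (- (s%:R * mu' phi'%:F)).
  elim: s => [|s IHs].
    rewrite mul0r oppr0 -(subrr (mu' phi'%:F)).
    exact: (small_valueB key nu0 aug).
  by rewrite -natr1 mulrDl mul1r opprD; apply: (small_valueB key nu0 aug).
rewrite -[s%:R * _]opprK; apply: (small_valueB key nu0 aug) => //.
apply: (small_value_ndiv key nu0 aug) => //; apply: (key_ndiv_unit key).
exact: (aug_unit key' nu'0 aug').
Qed.

Lemma chain_index c : is_maclane c ->
  value_group_index (chain_val c) (ramification (chain_val c)).
Proof.
elim: c => [|c IHc phi nu mu] mc.
  by rewrite (ramificationE (gauss_index v)); apply: gauss_index.
have small := chain_small mc; case: (mc) => mc' key nu0 aug _.
have idx := augmentation_index key aug small (IHc mc').
by rewrite /= (ramificationE idx).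
Qed.

Lemma ramification_step c phi nu mu : is_maclane (chainS c phi nu mu) ->
  ramification mu =
    (ramification (chain_val c) *
     `|denq ((ramification (chain_val c))%:R * nu)|)%N.
Proof.
move=> mc; have small := chain_small mc; case: (mc) => mc' key nu0 aug _.
exact: ramificationE (augmentation_index key aug small (chain_index mc')).
Qed.

Lemma chainS_e c phi nu mu : is_maclane (chainS c phi nu mu) ->
  chain_e (chainS c phi nu mu) =
    `|denq ((ramification (chain_val c))%:R * nu)|%N.
Proof.
move=> mc; rewrite /chain_e /= (ramification_step mc) mulKn //.
by case: mc => mc' _ _ _ _; case: (chain_index mc').
Qed.

(** With [chainS_e]: h and e are the numerator and denominator of e(mu_(r-1)) nu_r in lowest terms,
    hence coprime. *)
Lemma chainS_h c phi nu mu : is_maclane (chainS c phi nu mu) ->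
  chain_h (chainS c phi nu mu) = numq ((ramification (chain_val c))%:R * nu).
Proof.
move=> mc; rewrite /chain_h /= (ramification_step mc) natrM.
set x := _%:R * nu; rewrite mulrAC -/x.
have -> : `|denq x|%:R = (denq x)%:~R :> rat by rewrite -[in RHS]absz_denq.
by rewrite -numqE numq_int.
Qed.

Lemma chainS_V c phi nu mu : is_maclane (chainS c phi nu mu) ->
  (chain_V (chainS c phi nu mu))%:~R =
    (ramification (chain_val c))%:R * chain_val c phi%:F.
Proof.
move=> [mc key _ _ _]; rewrite /chain_V /=; have [_ idx] := chain_index mc.
have /intrP[k ->] := (idx _).1 (value_group_poly (chain_val c) (key_neq0 key)).
by rewrite numq_int.
Qed.

Lemma chain_e_gt0 c : is_maclane c -> (0 < chain_e c)%N.
Proof.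
case: c => [_|c phi nu mu mc]; last by rewrite chainS_e // absz_gt0 denq_neq0.
by rewrite /chain_e /= (ramificationE (gauss_index v)).
Qed.

Lemma chain_coprime c : is_maclane c -> coprimez (chain_h c) (chain_e c).
Proof.
case: c => [_|c phi nu mu mc].
  by rewrite /chain_e /= (ramificationE (gauss_index v)) coprimezE coprimen1.
by rewrite chainS_e // chainS_h // coprimezE absz_nat coprime_num_den.
Qed.

Lemma chain_lP c : is_maclane c ->
  (chain_l c).1 * chain_h c + (chain_l c).2 * (chain_e c)%:Z = 1 /\
  0 <= (chain_l c).1 < (chain_e c)%:Z.
Proof.
move=> mc; apply: (@xgetPex _ (0, 0) [set l : int * int |
  l.1 * chain_h c + l.2 * (chain_e c)%:Z = 1 /\
  0 <= l.1 < (chain_e c)%:Z]%classic).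
have e0 : (chain_e c)%:Z != 0 by have := chain_e_gt0 mc; case: (chain_e c).
have /coprimezP[[l l'] /= ll1] := chain_coprime mc.
(* Any Bezout pair works after reducing l modulo e and moving the quotient, times h, into the second
   coefficient. *)
exists ((l %% chain_e c)%Z, l' + (l %/ chain_e c)%Z * chain_h c); split=> /=.
  by rewrite -[RHS]ll1 {3}(divz_eq l (chain_e c)); ring.
by rewrite modz_ge0 // ltz_mod.
Qed.

Lemma chain_e1 c : is_maclane c -> chain_e c = 1%N -> chain_l c = (0, 1).
Proof.
move=> /chain_lP; case: (chain_l c) => l l' /= [ll1 lb] e1.
rewrite e1 in ll1 lb; have l0 : l = 0 by lia.
by move: ll1; rewrite l0 mul0r add0r mulr1 => ->.
Qed.

End Chains.

(** * Comparison of two chains *)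

Lemma mul_exprz_exp (R : comUnitRingType) (h p : R) (n : nat) (k l : int) :
  p \is a GRing.unit ->
  (h * p ^ (- k)) ^+ n * p ^ l = h ^+ n * p ^ (l - n%:Z * k).
Proof.
move=> up; rewrite exprMn -mulrA; congr (_ * _).
rewrite -[(p ^ - k) ^+ n]/((p ^ (- k)) ^ n%:Z) exprz_exp -exprzDr //.
by rewrite mulNr addrC [k * _]mulrC.
Qed.

Lemma size_monic_sub (R : nzRingType) (p q : {poly R}) :
  p \is monic -> q \is monic -> size p = size q -> (size (q - p)%R < size p)%N.
Proof.
move=> mp mq pq; have := monic_neq0 mp; rewrite -size_poly_gt0.
case sp: (size p) => [|n] // _; rewrite ltnS; apply/leq_sizeP => j.
rewrite leq_eqVlt coefB => /orP[/eqP <-|lt]; last first.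
  by rewrite !nth_default ?subrr // -?pq sp.
have := monicP mp; have := monicP mq; rewrite !lead_coefE -pq sp /= => -> ->.
exact: subrr.
Qed.

Section Comparison.
Variables (K : fieldType) (v : discrete_valuation K) (pi : K).
Hypothesis hpi : generates_maximal_ideal v pi.
Implicit Types (c : chain v) (mu : valuation v) (phi g : {poly K}).

(* p_{r+1}, viewed in Gr(mu) for any mu above mu_r *)
Definition next_p c mu : Gr mu :=
  gr_map mu (x_from_p (chain_p pi c)) ^ (chain_l c).1 *
  gr_map mu (chain_p pi c) ^ (chain_l c).2.

Lemma chain_pS c phi nu mu : chain_p pi (chainS c phi nu mu) = next_p c mu.
Proof. by []. Qed.

Lemma valuation_le_trans mu1 mu2 mu3 :
  valuation_le mu1 mu2 -> valuation_le mu2 mu3 -> valuation_le mu1 mu3.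
Proof. by move=> le12 le23 g g0; apply: le_trans (le12 g g0) (le23 g g0). Qed.

Lemma uniformizer_neq0 : pi != 0.
Proof.
case: hpi => _ hm; have [a a0 va] := dval_surj v 1.
have [|b _ abE] := hm a; first by right; rewrite va.
by apply: contra_neq a0 => pi0; rewrite abE pi0 mulr0.
Qed.

(** Describes how [chain_phi c] enters the next p. For the empty chain nothing is known about x, but
    e_0 = 1 makes its exponent l_0 zero. *)
Lemma maclane_ndiv_unit c phi nu mu : is_maclane (chainS c phi nu mu) ->
  (if c is chain0 then chain_l c = (0, 1)
   else initial mu (chain_phi c) \is a GRing.unit /\
        mu (chain_phi c)%:F = chain_val c (chain_phi c)%:F).
Proof.
move=> [mc key nu0 aug]; case: c mc key aug => [|c phi' nu' mu'] mc key aug nd.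
  apply: chain_e1 => //.
  by rewrite /chain_e /= (ramificationE (gauss_index v)).
have phi'0 : phi' != 0 by case: mc => _ /key_neq0.
split; first exact: (aug_ndiv_unit key nu0 aug).
by have [] := aug_ndiv key nu0 aug phi'0 nd.
Qed.

Lemma chain_p_unit c : is_maclane c -> chain_p pi c \is a GRing.unit.
Proof.
elim: c => [_|c IHc phi nu mu mc].
  have piP0 : pi%:P != 0 by rewrite polyC_eq0 uniformizer_neq0.
  have piV0 : (pi^-1)%:P != 0 by rewrite polyC_eq0 invr_eq0 uniformizer_neq0.
  apply/unitrPr; exists (initial (gauss v) (pi^-1)%:P).
  by rewrite -initialM // -polyCM mulfV ?uniformizer_neq0 // initial1.
rewrite chain_pS /next_p.
have [mc' key nu0 aug _] := mc; have le := aug_le key nu0 aug.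
have up := IHc mc'; rewrite unitrM [X in _ && X]unitrXz ?gr_map_unit // andbT.
have := maclane_ndiv_unit mc; case: (c) up le => [|c' phi' nu' mu'] up le.
  by move=> ->; rewrite expr0z unitr1.
move=> [uphi valphi]; rewrite unitrXz // /x_from_p gr_mapM // unitrM.
by rewrite gr_map_initial // uphi gr_map_unit // unitrXz.
Qed.

(** The condition under which [next_p c mu] is meaningful: phi_r keeps its value, so its initial
    form is carried to its initial form for mu. The empty chain is exempt since l_0 = 0. *)
Definition lies_below c mu : Prop :=
  [/\ is_maclane c, valuation_le (chain_val c) mu &
      if c is chain0 then True
      else mu (chain_phi c)%:F = chain_val c (chain_phi c)%:F].

(** The previous key polynomial has a unit as initial form for mu1, so it gains no value in passing
    to mu. *)
Lemma lies_below_prev c phi nu mu1 mu :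
  lies_below (chainS c phi nu mu1) mu -> lies_below c mu.
Proof.
move=> [mc le _]; have [mc' key nu0 aug _] := mc.
have le1 := aug_le key nu0 aug.
split=> //; first exact: valuation_le_trans le1 le.
have := maclane_ndiv_unit mc; case: (c) mc' => // c' phi' nu' mu' mc' [u <-].
by apply: val_unit => //; case: mc' => _ /key_neq0.
Qed.

(** Polynomials of degree less than deg phi have unit initial forms for mu1, so mu, mu1 and the
    valuation before mu1 agree on them. *)
Lemma below_small c phi nu mu1 mu : lies_below (chainS c phi nu mu1) mu ->
  forall al, value_group (chain_val c) al <-> small_value phi mu al.
Proof.
move=> [mc le _]; have [mc' key nu0 aug _] := mc => al.
have eq_small (a : {poly K}) :
    a != 0 -> (size a < size phi)%N -> mu a%:F = mu1 a%:F.
  by move=> a0 lt; apply: val_unit => //; apply: (aug_unit key nu0 aug).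
split=> [/(chain_small mc) [a [a0 lt <-]]|[a [a0 lt <-]]].
  by exists a; rewrite eq_small.
rewrite eq_small // (aug_small key aug) //; exact: value_group_poly.
Qed.

Lemma next_p_map c phi nu mu1 mu : lies_below (chainS c phi nu mu1) mu ->
  gr_map mu (chain_p pi (chainS c phi nu mu1)) = next_p c mu.
Proof.
move=> [mc le _]; have [mc' key nu0 aug _] := mc.
have le1 := aug_le key nu0 aug; have le' := valuation_le_trans le1 le.
have up := chain_p_unit mc'; rewrite chain_pS /next_p.
(* Since l >= 0, the power of x is a natural one and commutes with [gr_map] even if x is not a
   unit. *)
have [_ /andP[]] := chain_lP mc'.
move: (x_from_p _) => x; move: (chain_p pi c) up => p up.
case: (chain_l c) => -[] // n l _ _ /=; have up1 := gr_map_unit le1 up.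
have compE := gr_map_comp _ le1 le le'.
refine (etrans (gr_map_monomial le _ n l up1) _).
by congr (_ ^+ _ * _ ^ _); apply: compE.
Qed.

Lemma next_p_unit c phi nu mu1 mu : lies_below (chainS c phi nu mu1) mu ->
  next_p c mu \is a GRing.unit.
Proof.
move=> below; rewrite -(next_p_map below); have [mc le _] := below.
exact: gr_map_unit (chain_p_unit mc).
Qed.

(** Substituting x_r = H(phi_r) p_r^(-V_r) into x_r^l p_r^l' gives the exponent l' - l V_r of
    p_r. *)
Lemma next_p_step c phi nu mu1 mu (d := chainS c phi nu mu1) :
  lies_below d mu ->
  next_p d mu = initial mu phi ^ (chain_l d).1 *
    next_p c mu ^ ((chain_l d).2 - (chain_l d).1 * chain_V d).
Proof.
move=> below; have [mc le valphi] := below; have up := chain_p_unit mc.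
have uq := next_p_unit below; rewrite /next_p -/d.
have [_ /andP[]] := chain_lP mc; rewrite -/d; case: (_.1) => // n _ _.
have -> : gr_map mu (x_from_p (chain_p pi d)) =
    initial mu phi * next_p c mu ^ (- chain_V d).
  refine (etrans (gr_map_initial_Xz le (- chain_V d) valphi up) _).
  exact: (congr1 (fun q => initial mu phi * q ^ (- chain_V d))
    (next_p_map below)).
rewrite (next_p_map below); exact: mul_exprz_exp.
Qed.

(** Since mu_r(phi_r) = mu_(r-1)(phi_r) + nu_r, multiplying by e(mu_r) gives e_r V_r + h_r; the
    terms with V_r cancel and l h_r + l' e_r = 1 remains. *)
Lemma chain_bezout c phi nu mu1 (d := chainS c phi nu mu1) : is_maclane d ->
  (chain_l d).1%:~R * ((ramification mu1)%:R * mu1 phi%:F) +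
  ((chain_l d).2 - (chain_l d).1 * chain_V d)%:~R * (chain_e d)%:R = 1 :> rat.
Proof.
move=> mc; have [ll1 _] := chain_lP mc; have [mc' key nu0 aug _] := mc.
have VE := chainS_V mc; rewrite -/d in ll1 VE.
have hE : (chain_h d)%:~R =
    (chain_e d)%:R * ((ramification (chain_val c))%:R * nu).
  rewrite /d chainS_h // chainS_e // numqE mulrC; congr (_ * _).
  by rewrite -[in LHS]absz_denq.
have EE : ramification mu1 = (ramification (chain_val c) * chain_e d)%N.
  by rewrite /d chainS_e // (ramification_step mc).
have := congr1 (intr : int -> rat) ll1.
rewrite EE (aug_phi key aug) !(intrD, intrN, intrM) hE VE natrM => eq1.
rewrite -[RHS]eq1 -[(chain_e d)%:Z%:~R]/((chain_e d)%:R); ring.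
Qed.

(** [chain_bezout] divided by e(mu_r) writes 1/e(mu_r) as an integral combination of mu_r(phi_r) and
    1/e(mu_(r-1)). *)
Lemma value_group_invr c phi nu mu1 mu (d := chainS c phi nu mu1) :
  is_maclane d ->
  (forall al, value_group (chain_val c) al -> value_group mu al) ->
  value_group mu (mu1 phi%:F) -> value_group mu (ramification mu1)%:R^-1.
Proof.
move=> mc sub Gphi; have bez := chain_bezout mc; have [mc' _ _ _ _] := mc.
have [E0 idx] := chain_index mc'; have [E0' _] := chain_index mc.
have EE : ramification mu1 = (ramification (chain_val c) * chain_e d)%N.
  by rewrite /d chainS_e // (ramification_step mc).
rewrite -/d in bez; set l := (chain_l d).1 in bez; set l' := (_ - _) in bez.
have e0 := chain_e_gt0 mc; rewrite -/d in e0.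
have -> : (ramification mu1)%:R^-1 =
    l%:~R * mu1 phi%:F + l'%:~R * (ramification (chain_val c))%:R^-1 :> rat.
  have En0 : (ramification (chain_val c))%:R != 0 :> rat.
    by rewrite pnatr_eq0 -lt0n.
  have en0 : (chain_e d)%:R != 0 :> rat by rewrite pnatr_eq0 -lt0n.
  rewrite -[LHS]mulr1 -[X in _^-1 * X]bez EE natrM; field.
  by rewrite En0 en0.
apply: value_groupD; first exact: value_groupMz.
apply/value_groupMz/sub/idx; rewrite mulfV ?rpred1 // pnatr_eq0 -lt0n //.
Qed.

(** The value group here is (1/E) Z, and it contains 1/(E e) only for e = 1. *)
Lemma chain_e_eq1 c phi nu mu1 (d := chainS c phi nu mu1) : is_maclane d ->
  value_group (chain_val c) (ramification mu1)%:R^-1 -> chain_e d = 1%N.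
Proof.
move=> mc; have [mc' _ _ _ _] := mc; have [E0 idx] := chain_index mc'.
have e0 := chain_e_gt0 mc; rewrite -/d in e0.
have EE : ramification mu1 = (ramification (chain_val c) * chain_e d)%N.
  by rewrite /d chainS_e // (ramification_step mc).
move=> /idx; rewrite EE natrM invfM mulrA mulfV ?mul1r; last first.
  by rewrite pnatr_eq0 -lt0n.
have en0 : (chain_e d)%:R != 0 :> rat by rewrite pnatr_eq0 -lt0n.
move=> /intrP[k kE].
have ke1 : k * (chain_e d)%:Z = 1.
  by apply/eqP; rewrite -(eqr_int rat) intrM -kE mulVf.
have : ((chain_e d)%:Z %| 1)%Z by apply/dvdzP; exists k.
by rewrite dvdzE dvdn1 => /eqP.
Qed.

(** If deg phi < deg psi, phi and all polynomials of smaller degree have values in the group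
    preceding mu2. It then contains 1/e(mu1) = 1/e(mu2), which forces e = 1 in the second chain. *)
Lemma size_phi_le c1 phi nu mu1 c2 psi nu' mu2 mu
    (d1 := chainS c1 phi nu mu1) (d2 := chainS c2 psi nu' mu2) :
  lies_below d1 mu -> lies_below d2 mu -> ramification mu1 = ramification mu2 ->
  chain_e d2 != 1%N -> (size psi <= size phi)%N.
Proof.
move=> b1 b2 E12 e2; rewrite leqNgt; apply/negP => lt; move/negP: e2; apply.
have [mc1 _ phiE] := b1; have [mc2 _ _] := b2.
have [_ key1 _ _ _] := mc1.
apply/eqP/chain_e_eq1 => //; rewrite -E12.
apply: (value_group_invr mc1) => [al|].
  move=> /(below_small b1)[a [a0 lta aE]]; apply/(below_small b2).
  by exists a; rewrite (ltn_trans lta lt).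
apply/(below_small b2); exists phi; rewrite lt phiE; split=> //.
exact: key_neq0 key1.
Qed.

Lemma lies_below_notin c phi nu mu1 mu (d := chainS c phi nu mu1) :
  lies_below d mu -> chain_e d != 1%N ->
  ~ value_group (chain_val c) (mu phi%:F).
Proof.
move=> b e1 Gphi; move/negP: e1; apply; have [mc _ phiE] := b.
apply/eqP/chain_e_eq1 => //; apply: (value_group_invr mc) => //.
by rewrite -[mu1 _]phiE.
Qed.

(* [l] and [m] are inverses of [N] modulo [e], and lie in [0, e[. *)
Lemma bezout_unique (l l' m m' N : int) (e : nat) :
  l * N + l' * e%:Z = 1 -> m * N + m' * e%:Z = 1 ->
  0 <= l < e%:Z -> 0 <= m < e%:Z -> l = m /\ l' = m'.
Proof.
move=> lE mE lb mb.
have cop : coprimez e N.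
  by rewrite coprimez_sym; apply/coprimezP; exists (l, l').
have : (e%:Z %| (l - m) * N)%Z.
  by apply/dvdzP; exists (m' - l'); rewrite mulrBl mulrBl; lia.
rewrite Gauss_dvdzl // => /dvdzP[k kE].
(* The bounds give |l - m| < e, while l - m = k e. *)
have k0 : k = 0 by nia.
have lm : l = m by move: kE; rewrite k0 mul0r => /eqP; rewrite subr_eq0 => /eqP.
split=> //; have e0 : e%:Z != 0 by lia.
by apply: (mulIf e0); apply: (addrI (l * N)); rewrite lE lm mE.
Qed.

Lemma initial_key_unique c1 phi nu mu1 c2 psi nu' mu2 mu
    (d1 := chainS c1 phi nu mu1) (d2 := chainS c2 psi nu' mu2) :
  lies_below d1 mu -> lies_below d2 mu -> ramification mu1 = ramification mu2 ->
  chain_e d1 != 1%N -> chain_e d2 != 1%N ->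
  [/\ ramification (chain_val c1) = ramification (chain_val c2),
      mu psi%:F = mu phi%:F & initial mu psi = initial mu phi].
Proof.
move=> b1 b2 E12 e1 e2.
have size_eq : size phi = size psi.
  apply/eqP; rewrite eqn_leq (size_phi_le b2 b1 (esym E12) e1).
  exact: size_phi_le b1 b2 E12 e2.
have [mc1 _ phiE] := b1; have [mc2 _ psiE] := b2.
have [mc1' key1 _ _ _] := mc1; have [mc2' key2 _ _ _] := mc2.
have G12 al : value_group (chain_val c1) al <-> value_group (chain_val c2) al.
  have S : small_value phi mu al = small_value psi mu al.
    by rewrite /small_value size_eq.
  apply: (iff_trans (below_small b1 al)); rewrite S.
  exact: iff_sym (below_small b2 al).
have Ec : ramification (chain_val c1) = ramification (chain_val c2).
  apply: ramificationE; have [E0 idx] := chain_index mc2'.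
  by split; [exact: E0 | move=> al; apply: (iff_trans (G12 al)); apply: idx].
have n1 := lies_below_notin b1 e1; have n2 := lies_below_notin b2 e2.
(* The value of psi - phi lies in the common preceding value group. It cannot equal mu(phi), which
   does not, nor be smaller, as mu(psi) would then lie in that group. *)
have dom : Pgt mu (mu phi%:F) (psi - phi).
  have [->|a0] := eqVneq (psi - phi) 0; [by left|right].
  have lt : (size (psi - phi)%R < size phi)%N.
    exact: size_monic_sub (key_monic key1) (key_monic key2) size_eq.
  have Ga : value_group (chain_val c1) (mu (psi - phi)%:F).
    apply/(below_small b1).
    by exists (psi - phi); split; [exact: a0|exact: lt|].
  rewrite ltNge le_eqVlt; apply/norP; split.
    by apply/eqP => aE; apply: n1; rewrite -aE.
  apply/negP => lta; apply: n2.
  have [_ E _] := val_dominated (h := phi) a0 (or_intror lta).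
  by move: E; rewrite subrK => ->; apply/G12.
have [_] := val_dominated (key_neq0 key1) dom.
rewrite addrC subrK => psi_val psi_init; by split; [exact: Ec| |].
Qed.

(** The hypothesis compares ramification indices only, because this is all that passes to the
    shortened chains: their valuations are not known to agree. *)
Lemma next_p_unique mu c cs : lies_below c mu -> lies_below cs mu ->
  ramification (chain_val c) = ramification (chain_val cs) ->
  next_p c mu = next_p cs mu.
Proof.
have step_e1 c' phi nu mu1 : lies_below (chainS c' phi nu mu1) mu ->
    chain_e (chainS c' phi nu mu1) = 1%N ->
    next_p (chainS c' phi nu mu1) mu = next_p c' mu /\
    ramification mu1 = ramification (chain_val c').
  move=> b e1; have [mc _ _] := b; split.
    by rewrite next_p_step // chain_e1 // expr0z mul1r mul0r subr0 expr1z.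
  by rewrite (ramification_step mc) -(chainS_e mc) e1 muln1.
have ram0 : ramification (gauss v) = 1%N := ramificationE (gauss_index v).
have ram1 c' phi nu mu1 : lies_below (chainS c' phi nu mu1) mu ->
    ramification mu1 = 1%N -> chain_e (chainS c' phi nu mu1) = 1%N.
  move=> [mc _ _]; rewrite (ramification_step mc) -(chainS_e mc).
  by move/eqP; rewrite muln_eq1 => /andP[_ /eqP].
elim: c cs => [|c IHc phi nu mu1] cs b1.
  elim: cs => [|cs IHcs psi nu' mu2]; first by [].
  move=> b2 E12; have r2 : ramification mu2 = 1%N := etrans (esym E12) ram0.
  have [-> E2] := step_e1 _ _ _ _ b2 (ram1 _ _ _ _ b2 r2).
  exact: IHcs (lies_below_prev b2) (etrans E12 E2).
(* Steps with e = 1 change neither p nor the ramification index and are removed from either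
   chain. *)
have [e1|e1] := eqVneq (chain_e (chainS c phi nu mu1)) 1%N.
  have [-> E1] := step_e1 _ _ _ _ b1 e1 => b2 E12.
  exact: IHc (lies_below_prev b1) b2 (etrans (esym E1) E12).
elim: cs => [|cs IHcs psi nu' mu2] b2 E12.
  by case/eqP: e1; apply: (ram1 _ _ _ _ b1 (etrans E12 ram0)).
have {}E12 : ramification mu1 = ramification mu2 := E12.
have [e2|e2] := eqVneq (chain_e (chainS cs psi nu' mu2)) 1%N.
  have [-> E2] := step_e1 _ _ _ _ b2 e2.
  exact: IHcs (lies_below_prev b2) (etrans E12 E2).
have [Ec psi_val psi_init] := initial_key_unique b1 b2 E12 e1 e2.
have [mc1 _ phiE] := b1; have [mc2 _ psiE] := b2.
have [_ key1 _ _ _] := mc1.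
(* Both steps now have e > 1. They share e and N = e(mu1) mu1(phi), hence the same reduced Bezout
   pair, so the exponents agree. *)
have ee : chain_e (chainS c phi nu mu1) = chain_e (chainS cs psi nu' mu2).
  by rewrite /chain_e /= E12 Ec.
rewrite (next_p_step b1) (next_p_step b2) psi_init.
rewrite (IHc cs (lies_below_prev b1) (lies_below_prev b2) Ec).
have [_ lb1] := chain_lP mc1; have [_ lb2] := chain_lP mc2.
have bez1 := chain_bezout mc1; have bez2 := chain_bezout mc2.
have phi12 : mu2 psi%:F = mu1 phi%:F by rewrite -[LHS]psiE -[RHS]phiE.
rewrite phi12 -ee -E12 in bez2 lb2.
have [_ idx1] := chain_index mc1.
have /intrP[N NE] := (idx1 _).1 (value_group_poly mu1 (key_neq0 key1)).
rewrite NE in bez1 bez2.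
have toint (x y : int) (e : nat) :
    x%:~R * N%:~R + y%:~R * e%:R = 1 :> rat -> x * N + y * e%:Z = 1.
  by move=> E; apply: (@intr_inj rat); rewrite intrD !intrM.
have [-> ->] := bezout_unique (toint _ _ _ bez1) (toint _ _ _ bez2) lb1 lb2.
by [].
Qed.

End Comparison.

(** * Generators and residual operators of the common last step *)

Theorem theorem3p2 (K : fieldType) (v : discrete_valuation K) (pi : K)
    (hpi : generates_maximal_ideal v pi)
    (mu : valuation v) (hmu : inductive_valuation mu)
    (phi : {poly K}) (hphi : proper_key_polynomial mu phi)
    (nu : rat) (hnu : 0 < nu)
    (mu' : valuation v) (hmu' : augmentation mu phi nu mu')
    (c cs : chain v)
    (hc : maclane_chain c mu) (hcs : maclane_chain cs mu)
    (hcphi : ~ mu_divides mu phi (chain_phi c))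
    (hcsphi : ~ mu_divides mu phi (chain_phi cs)) :
  let d := chainS c phi nu mu' in
  let ds := chainS cs phi nu mu' in
  [/\ chain_p pi d = chain_p pi ds :> Gr mu',
      chain_x pi d = chain_x pi ds :> Gr mu',
      chain_y pi d = chain_y pi ds :> Gr mu',
      forall g : {poly K}, g != 0 -> chain_newton d g = chain_newton ds g &
      forall g : {poly K}, residual pi d g = residual pi ds g :> {poly Gr mu'}].
Proof.
have [mc cE] := hc; have [mcs csE] := hcs.
have [key _] := hphi.
(* As phi does not divide the last key polynomial of the chain, that polynomial keeps its value in
   mu'. *)
have below c0 : maclane_chain c0 mu -> ~ mu_divides mu phi (chain_phi c0) ->
    lies_below c0 mu'.
  move=> [mc0 E] nd; split=> //.
    by rewrite E; exact: (aug_le key hnu hmu').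
  case: c0 mc0 E nd => // c1 phi1 nu1 mu1 mc0 /= E nd; rewrite E.
  have phi10 : phi1 != 0 by case: mc0 => _ /key_neq0.
  by have [] := aug_ndiv key hnu hmu' phi10 nd.
move=> d ds.
have pE : chain_p pi d = chain_p pi ds :> Gr mu'.
  apply: (next_p_unique hpi (below c hc hcphi) (below cs hcs hcsphi)).
  by rewrite cE csE.
(* Everything else is computed from mu, phi, nu, mu' and p. *)
have VE : chain_V d = chain_V ds by rewrite /chain_V /= cE csE.
have eE : chain_e d = chain_e ds by rewrite /chain_e /= cE csE.
have xE : chain_x pi d = chain_x pi ds :> Gr mu'.
  exact: (congr2 (fun (p : Gr mu') k => initial mu' phi * p ^ (- k)) pE VE).
have yE : chain_y pi d = chain_y pi ds :> Gr mu'.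
  rewrite /chain_y eE.
  exact: (congr2 (fun x p : Gr mu' =>
    x ^+ chain_e ds * p ^ (- chain_h ds)) xE pE).
have NE g : chain_newton d g = chain_newton ds g.
  by rewrite /chain_newton /= cE csE.
have suE g : chain_su d g = chain_su ds g.
  by rewrite /chain_su NE /= cE csE.
have FE : chain_field d = chain_field ds :> set (Gr mu') by rewrite /= cE csE.
split; [exact: pE|exact: xE|exact: yE|by move=> g _; apply: NE|move=> g].
(* [residual] is an [xget] choice, so equal predicates yield equal polynomials. *)
have residualE : @is_residual K v pi d g = @is_residual K v pi ds g.
  apply/funext => R; apply/propext; rewrite /is_residual suE FE.
  have -> : chain_x pi d = chain_x pi ds := xE.
  have -> : chain_y pi d = chain_y pi ds := yE.
  have -> : chain_p pi d = chain_p pi ds := pE.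
  exact: iff_refl.
by rewrite /residual residualE.
Qed.
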